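(* Let $H=G/K$ be a Riemannian homogeneous space of $G$, let $V:H\to\mathbb{R}$ be a potential function, $\tilde V=V\circ\pi$, and suppose $\mathfrak h=\mathfrak f\oplus\mathfrak d$. Let $\tilde u^{*}:\mathfrak d\to U$ be the unique control law making $\mathfrak d$ a virtual nonholonomic constraint, and let $(g,\xi):[a,b]\to G\times\mathfrak g$ be the solution of the associated closed-loop system $$\dot g=(T_eL_g)(\xi),\qquad \dot\xi+\tilde\nabla^{\mathfrak g}_{\xi}\xi+(T_gL_{g^{-1}})\big(\widetilde{\mathrm{grad}}\,\tilde V(g(t))\big)=\sum_{c=1}^m\tilde u^{*c}(\xi)f_c$$ with $\xi(a)\in\mathfrak d$. If $q(t)=\pi(g(t))$, then $\dot q(t)\in\mathcal D_{q(t)}$, $g(t)=\tilde q(t)$ (that is, $g$ is the horizontal lift of $q$ starting at $g(a)$), and $q$ satisfies $$\nabla_{\dot q(t)}\dot q(t)=-\mathrm{grad}\,V(q(t))+\sum_{c=1}^m u^{*c}(t)Y_c(q(t)),$$ with $u^{*c}(t):=u^{*c}(q(t),\dot q(t))=\tilde u^{*c}(\xi(t))$, where $\xi(t)=T_{\tilde q(t)}L_{\tilde q(t)^{-1}}\dot{\tilde q}(t)$.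
   Context: Setting. $G$ is a connected Lie group with identity $e$, Lie algebra $\mathfrak g=T_eG$ and left translations $L_g$. $K\subset G$ is a closed Lie subgroup with Lie algebra $\mathfrak s$, $H=G/K$, $\pi:G\to H$ is the canonical projection and $\Phi_g([h])=[gh]$ is the transitive left action of $G$ on $H$. $G$ carries a left-invariant Riemannian metric, determined by an inner product on $\mathfrak g$. Put $\mathrm{Ver}_g=\ker T_g\pi$ and $\mathrm{Hor}_g=\mathrm{Ver}_g^{\perp}$. $H$ carries a Riemannian metric such that $\pi$ is a Riemannian submersion, i.e. $T_g\pi:\mathrm{Hor}_g\to T_{\pi(g)}H$ is a linear isometry for all $g$; then $H$ is called a Riemannian homogeneous space. Put $\mathfrak h=\mathrm{Hor}_e=\mathfrak s^\perp$, so $\mathfrak g=\mathfrak s\oplus\mathfrak h$ and $\mathrm{Hor}_g=T_eL_g(\mathfrak h)$. $\nabla,\tilde\nabla$ are the Levi-Civita connections of $H$ and $G$; $\mathrm{grad},\widetilde{\mathrm{grad}}$ are the gradients on $H$ and $G$. For $\xi\in\mathfrak g$, $\xi_L(g)=T_eL_g(\xi)$, and the Riemannian $\mathfrak g$-connection is $\tilde\nabla^{\mathfrak g}_\xi\eta=(\tilde\nabla_{\xi_L}\eta_L)(e)$. A horizontal lift of a curve $q:[a,b]\to H$ is a curve $\tilde q:[a,b]\to G$ with $\pi\circ\tilde q=q$ and $\dot{\tilde q}(t)\in\mathrm{Hor}_{\tilde q(t)}$ for all $t$; it is unique once $\tilde q(a)$ is fixed. Data of the control problem. $U\subset\mathbb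 R^m$ is the set of controls. $\mathcal D$ is a non-integrable distribution on $H$ that is $G$-invariant: $\mathcal D_{\Phi_g(\pi(e))}=T_{\pi(e)}\Phi_g(\mathcal D_{\pi(e)})$ for all $g\in G$; $\mathfrak d\subseteq\mathfrak h$ is the subspace with $T_e\pi(\mathfrak d)=\mathcal D_{\pi(e)}$. $Y_1,\dots,Y_m$ are $G$-invariant vector fields on $H$; $f_c\in\mathfrak h$ is defined by $T_e\pi(f_c)=Y_c(\pi(e))$; $\mathfrak f=\mathrm{span}\{f_1,\dots,f_m\}$, with $f_1,\dots,f_m$ a basis of $\mathfrak f$. Control law. A control law is a function $\tilde u:\mathfrak d\to U$ of $\xi$. It makes $\mathfrak d$ a virtual nonholonomic constraint for the system $\dot g=T_eL_g\xi$, $\dot\xi+\tilde\nabla^{\mathfrak g}_\xi\xi+T_gL_{g^{-1}}(\widetilde{\mathrm{grad}}\,\tilde V(g))=\sum_c\tilde u^cf_c$ if $\mathfrak d$ is invariant under the flow of the closed-loop system with $\tilde u^c=\tilde u^c(\xi(t))$, i.e. if $\xi(0)\in\mathfrak d$ then $\xi(t)\in\mathfrak d$ for all $t\ge0$. The paper's existence and uniqueness theorem asserts that, when $\mathfrak h=\mathfrak f\oplus\mathfrak d$, there is exactly one such control law; it is denoted $\tilde u^*$. *)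

(* Defs.v *)
(* Smooth manifolds are modelled on 'rV[R]_n and carry an atlas {chart p}_p
   indexed by their points, with p in the domain of chart p.  The tangent space
   T_pM is 'rV[R]_n, a tangent vector at p being given by its coordinates in
   chart p; tangent maps are read through these charts.  Objects that are only
   defined near a point are represented by total functions whose values away
   from that point are irrelevant. *)
From HB Require Import structures.
From mathcomp Require Import all_boot all_order all_algebra.
From mathcomp Require Import all_classical all_reals all_analysis.
Set Implicit Arguments.
Unset Strict Implicit.
Unset Printing Implicit Defensive.
Import Order.TTheory GRing.Theory Num.Theory.
Import numFieldNormedType.Exports.
Local Open Scope classical_set_scope.
Local Open Scope ring_scope.

Section SmoothEuclidean.
Context {R : realType} {V W : normedModType R}.

(* On an open set A of a finite-dimensional V, this is membership in C^k. *)
Fixpoint Ck (k : nat) (A : set V) (f : V -> W) : Prop :=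
  match k with
  | 0%N => forall x, A x -> {for x, continuous f}
  | k'.+1 => (forall x, A x -> differentiable f x) /\
             (forall v : V, Ck k' A (fun x => 'd f x v))
  end.

Definition smooth_on (A : set V) (f : V -> W) : Prop := forall k, Ck k A f.

Definition smooth_near (f : V -> W) (x : V) : Prop :=
  exists A : set V, [/\ open A, A x & smooth_on A f].

End SmoothEuclidean.

(* [ichart p] is the inverse of [chart p], relevant on [chart p @` dom p]. *)
HB.mixin Record isManifold (R : realType) (n : nat) M of Topological M := {
  dom : M -> set M;
  chart : M -> M -> 'rV[R]_n;
  ichart : M -> 'rV[R]_n -> M;
  hausdorff_manifold : hausdorff_space M;
  second_countable_manifold : @second_countable M;
  open_dom : forall p, open (dom p);
  mem_dom : forall p, dom p p;
  open_chart : forall p, open (chart p @` dom p);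
  chartK : forall p q, dom p q -> ichart p (chart p q) = q;
  continuous_chart : forall p q, dom p q -> {for q, continuous (chart p)};
  continuous_ichart : forall p x, (chart p @` dom p) x ->
    {for x, continuous (ichart p)};
  smooth_transition : forall p q,
    smooth_on (chart p @` (dom p `&` dom q)) (chart q \o ichart p)
}.

#[short(type="manifoldType")]
HB.structure Definition Manifold (R : realType) (n : nat) :=
  { M of Topological M & isManifold R n M }.

Section Manifolds.
Context {R : realType} {n m : nat} {M : manifoldType R n} {N : manifoldType R m}.

Definition smooth_map_near (f : M -> N) (p : M) : Prop :=
  {for p, continuous f} /\
  smooth_near (chart (f p) \o f \o ichart p) (chart p p).

Definition smooth_map (f : M -> N) : Prop := forall p, smooth_map_near f p.

(* T_p f : T_pM -> T_(f p)N *)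
Definition Tmap (f : M -> N) (p : M) : {linear 'rV[R]_n -> 'rV[R]_m} :=
  'd (chart (f p) \o f \o ichart p) (chart p p).

End Manifolds.

HB.mixin Record isLieGroup (R : realType) (n : nat) G
    of Group G & Manifold R n G := {
  continuous_mulg : continuous (fun x : G * G => (x.1 * x.2)%g);
  smooth_mulg : forall g h : G,
    smooth_near
      (fun x : 'rV[R]_n * 'rV[R]_n =>
         chart (g * h)%g (ichart g x.1 * ichart h x.2)%g : 'rV[R]_n)
      (chart g g, chart h h);
  smooth_invg : forall g : G,
    smooth_map_near (fun x : G => x^-1%g) g
}.

#[short(type="lieGroupType")]
HB.structure Definition LieGroup (R : realType) (n : nat) :=
  { G of Group G & Manifold R n G & isLieGroup R n G }.

Section VectorFields.
Context {R : realType} {n : nat} {M : manifoldType R n}.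

Definition smooth_fun_near (W : normedModType R) (f : M -> W) (p : M) : Prop :=
  smooth_near (f \o ichart p) (chart p p).

Definition dfun (f : M -> R^o) (p : M) (v : 'rV[R]_n) : R :=
  'd (f \o ichart p) (chart p p) v.

(* T_q (chart p) : T_qM -> R^n, for q in dom p, and its inverse *)
Definition to_chart (p q : M) (v : 'rV[R]_n) : 'rV[R]_n :=
  'd (chart p \o ichart q) (chart q q) v.
Definition of_chart (p q : M) (w : 'rV[R]_n) : 'rV[R]_n :=
  'd (chart q \o ichart p) (chart p q) w.

Definition smooth_field_near (X : M -> 'rV[R]_n) (p : M) : Prop :=
  smooth_fun_near (fun q => to_chart p q (X q)) p.

Definition smooth_field (X : M -> 'rV[R]_n) : Prop :=
  forall p, smooth_field_near X p.

(* [X, Y](p) = DY(p) X(p) - DX(p) Y(p) in the coordinates of chart p *)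
Definition lie_bracket (X Y : M -> 'rV[R]_n) (p : M) : 'rV[R]_n :=
  let local (Z : M -> 'rV[R]_n) x := to_chart p (ichart p x) (Z (ichart p x)) in
  'd (local Y) (chart p p) (X p) - 'd (local X) (chart p p) (Y p).

Definition riemannian_metric (met : M -> 'rV[R]_n -> 'rV[R]_n -> R) : Prop :=
  [/\ forall p (a : R) u v w, met p (a *: u + v) w = a * met p u w + met p v w,
      forall p v w, met p v w = met p w v,
      forall p v, v != 0 -> 0 < met p v v
    & forall p X Y, smooth_field_near X p -> smooth_field_near Y p ->
        smooth_fun_near (fun q => met q (X q) (Y q) : R^o) p].

Definition grad (met : M -> 'rV[R]_n -> 'rV[R]_n -> R) (f : M -> R^o) (p : M)
    : 'rV[R]_n :=
  xget 0 [set w | forall v, met p w v = dfun f p v].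

(* [nabla p v Y] is the derivative at p of the field Y, smooth near p, in the
   direction v of T_pM.  As the axioms are required of fields that are smooth
   only near p, [nabla p v Y] depends on the germ of Y at p only. *)
Definition affine_connection
    (nabla : M -> 'rV[R]_n -> (M -> 'rV[R]_n) -> 'rV[R]_n) : Prop :=
  [/\ forall p (a : R) v w Y, smooth_field_near Y p ->
        nabla p (a *: v + w) Y = a *: nabla p v Y + nabla p w Y,
      forall p v X Y, smooth_field_near X p -> smooth_field_near Y p ->
        nabla p v (fun q => X q + Y q) = nabla p v X + nabla p v Y,
      forall p v (f : M -> R^o) Y,
        smooth_fun_near f p -> smooth_field_near Y p ->
        nabla p v (fun q => f q *: Y q) = dfun f p v *: Y p + f p *: nabla p v Y
    & forall p X Y, smooth_field_near X p -> smooth_field_near Y p ->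
        smooth_field_near (fun q => nabla q (X q) Y) p].

Definition levi_civita (met : M -> 'rV[R]_n -> 'rV[R]_n -> R)
    (nabla : M -> 'rV[R]_n -> (M -> 'rV[R]_n) -> 'rV[R]_n) : Prop :=
  [/\ affine_connection nabla,
      forall p X Y, smooth_field_near X p -> smooth_field_near Y p ->
        nabla p (X p) Y - nabla p (Y p) X = lie_bracket X Y p
    & forall p v X Y, smooth_field_near X p -> smooth_field_near Y p ->
        dfun (fun q => met q (X q) (Y q)) p v =
        met p (nabla p v X) (Y p) + met p (X p) (nabla p v Y)].

(* A smooth subbundle of the tangent bundle, given by smooth local frames. *)
Definition smooth_distribution (D : M -> {vspace 'rV[R]_n}) : Prop :=
  forall p, exists k (X : 'I_k -> M -> 'rV[R]_n),
    (forall i, smooth_field_near (X i) p) /\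
    \forall q \near p, basis_of (D q) [seq X i q | i <- enum 'I_k].

(* Through every point passes an (immersed) integral manifold, parametrized
   near that point by phi. *)
Definition integrable_distribution (D : M -> {vspace 'rV[R]_n}) : Prop :=
  forall p, exists k (phi : 'rV[R]_k -> M),
    [/\ phi 0 = p,
        {for 0, continuous phi},
        smooth_near (chart p \o phi) 0
      & \forall x \near (0 : 'rV[R]_k),
          let dphi := linfun ('d (chart (phi x) \o phi) x) in
          lker dphi == 0%VS /\ limg dphi = D (phi x)].

End VectorFields.

Section Curves.
Context {R : realType}.

(* Derivative at t of a curve on the interval I, one-sided at the endpoints. *)
Definition is_deriv_within (W : normedModType R) (I : set R) (c : R -> W)
    (t : R) (v : W) : Prop :=
  (fun s => (s - t)^-1 *: (c s - c t)) @ within I (t^') --> v.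

Context {n : nat} {M : manifoldType R n}.

Definition is_velocity (I : set R) (q : R -> M) (t : R) (v : 'rV[R]_n) : Prop :=
  (q @ within I (nbhs t) --> q t) /\
  is_deriv_within I (fun s => chart (q t) (q s)) t v.

(* a is the covariant derivative at t of the field Z along q.  In the chart at
   q t, writing Z(s) = Z^i(s) d_i(q(s)), it is
   (dZ^i/ds)(t) d_i + nabla_(q'(t)) (Z^i(t) d_i). *)
Definition is_covariant_deriv
    (nabla : M -> 'rV[R]_n -> (M -> 'rV[R]_n) -> 'rV[R]_n)
    (I : set R) (q : R -> M) (Z : R -> 'rV[R]_n) (t : R) (a : 'rV[R]_n) : Prop :=
  exists v dZ, [/\ is_velocity I q t v,
    is_deriv_within I (fun s => to_chart (q t) (q s) (Z s)) t dZ
    & a = dZ + nabla (q t) v (fun p => of_chart (q t) p (Z t))].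

End Curves.

Section LieGroups.
Context {R : realType} {n : nat} {G : lieGroupType R n}.

Definition Tleft (g h : G) : {linear 'rV[R]_n -> 'rV[R]_n} :=
  Tmap (fun x : G => (g * x)%g) h.

Definition left_inv_field (xi : 'rV[R]_n) (g : G) : 'rV[R]_n := Tleft g 1%g xi.

Definition left_invariant_metric (met : G -> 'rV[R]_n -> 'rV[R]_n -> R) : Prop :=
  forall g h v w, met (g * h)%g (Tleft g h v) (Tleft g h w) = met h v w.

Definition nabla_g (nabla : G -> 'rV[R]_n -> (G -> 'rV[R]_n) -> 'rV[R]_n)
    (xi eta : 'rV[R]_n) : 'rV[R]_n :=
  nabla 1%g (left_inv_field xi 1%g) (left_inv_field eta).

(* By Cartan's theorem, the closed Lie subgroups are the closed subgroups. *)
Definition closed_subgroup (K : set G) : Prop :=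
  [/\ closed K, K 1%g, forall x y, K x -> K y -> K (x * y)%g
    & forall x, K x -> K x^-1%g].

End LieGroups.

Section HomogeneousSpaces.
Context {R : realType} {n k : nat} {G : lieGroupType R n} {H : manifoldType R k}.

(* H is G / K with projection pi and action Phi: the fibres of pi are the left
   cosets of K, and the smooth structure of G / K is the one that makes pi a
   smooth submersion. *)
Definition homogeneous_space (K : set G) (pi : G -> H) (Phi : G -> H -> H)
    : Prop :=
  [/\ forall p, exists g, pi g = p,
      forall g h, pi g = pi h <-> K (g^-1 * h)%g,
      smooth_map pi,
      forall g w, exists v, Tmap pi g v = w
    & forall g h, Phi g (pi h) = pi (g * h)%g].

Definition Hor (metG : G -> 'rV[R]_n -> 'rV[R]_n -> R) (pi : G -> H) (g : G)
    : set 'rV[R]_n :=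
  [set v | forall w, Tmap pi g w = 0 -> metG g v w = 0].

Definition riemannian_submersion
    (metG : G -> 'rV[R]_n -> 'rV[R]_n -> R)
    (metH : H -> 'rV[R]_k -> 'rV[R]_k -> R) (pi : G -> H) : Prop :=
  forall g,
    (forall v w, Hor metG pi g v -> Hor metG pi g w ->
       metH (pi g) (Tmap pi g v) (Tmap pi g w) = metG g v w) /\
    (forall u, exists2 v, Hor metG pi g v & Tmap pi g v = u).

Definition horizontal_lift (metG : G -> 'rV[R]_n -> 'rV[R]_n -> R)
    (pi : G -> H) (I : set R) (q : R -> H) (qt : R -> G) : Prop :=
  forall t, I t -> pi (qt t) = q t /\
    exists2 v, is_velocity I qt t v & Hor metG pi (qt t) v.

(* qt is the horizontal lift of q : [a, b] -> H starting at g0 *)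
Definition is_the_horizontal_lift (metG : G -> 'rV[R]_n -> 'rV[R]_n -> R)
    (pi : G -> H) (a b : R) (q : R -> H) (g0 : G) (qt : R -> G) : Prop :=
  [/\ qt a = g0, horizontal_lift metG pi `[a, b] q qt
    & forall qt', qt' a = g0 -> horizontal_lift metG pi `[a, b] q qt' ->
        forall t, t \in `[a, b] -> qt' t = qt t].

Definition invariant_field (Phi : G -> H -> H) (Y : H -> 'rV[R]_k) : Prop :=
  forall g p, Y (Phi g p) = Tmap (Phi g) p (Y p).

Definition invariant_distribution (pi : G -> H) (Phi : G -> H -> H)
    (D : H -> {vspace 'rV[R]_k}) : Prop :=
  forall g, D (Phi g (pi 1%g)) =
            (linfun (Tmap (Phi g) (pi 1%g)) @: D (pi 1%g))%VS.

End HomogeneousSpaces.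

Section ControlSystem.
Context {R : realType} {n m : nat} {G : lieGroupType R n}.
Context (metG : G -> 'rV[R]_n -> 'rV[R]_n -> R)
  (nablaG : G -> 'rV[R]_n -> (G -> 'rV[R]_n) -> 'rV[R]_n)
  (Vt : G -> R^o) (f : 'I_m -> 'rV[R]_n) (d : {vspace 'rV[R]_n}).

(* Control laws u : d -> R^m are evaluated at xi in g through the linear
   projection [vsproj d], which is the identity on d. *)
Definition closed_loop_solution (u : subvs_of d -> 'rV[R]_m) (I : set R)
    (g : R -> G) (xi : R -> 'rV[R]_n) : Prop :=
  forall t, I t ->
    is_velocity I g t (Tleft (g t) 1%g (xi t)) /\
    exists2 dxi, is_deriv_within I xi t dxi &
      dxi + nabla_g nablaG (xi t) (xi t)
          + Tleft (g t)^-1%g (g t) (grad metG Vt (g t))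
      = \sum_(c < m) u (vsproj d (xi t)) 0 c *: f c.

(* The flow starting in G x d exists (locally in time), and d is invariant. *)
Definition makes_vnc (u : subvs_of d -> 'rV[R]_m) : Prop :=
  (forall g0 xi0, xi0 \in d -> exists T g xi,
     [/\ 0 < T, closed_loop_solution u `[0, T] g xi, g 0 = g0 & xi 0 = xi0]) /\
  (forall T g xi, 0 < T -> closed_loop_solution u `[0, T] g xi ->
     xi 0 \in d -> forall t, t \in `[0, T] -> xi t \in d).

Definition is_the_vnc_control_law (U : set 'rV[R]_m)
    (u : subvs_of d -> 'rV[R]_m) : Prop :=
  [/\ forall x, U (u x), makes_vnc u
    & forall u', (forall x, U (u' x)) -> makes_vnc u' -> u' =1 u].

End ControlSystem.

(* Main.v *)
(* Write q = pi o g.  Invariance of d under the closed loop keeps xi horizontal,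
   so g' = T L_g xi is horizontal and projects to q'.  For the equation of q
   at a time t0, translate by g(t0)^-1 and project the left-invariant fields of
   G to the chart of H at q(t0), obtaining a family A(x) : g -> R^k with
   A(1) = T pi o T L_g(t0).  Since G acts on H by isometries, A(x) pulls the
   metric of H back to a form independent of x.  Differentiating this identity,
   and using that second derivatives commute, expresses the Christoffel symbols
   of H through Lie brackets of left-invariant fields:
     < nabla_q' q', A eta > = < xi', eta > - < xi, [xi, eta] >,
   and the Koszul formula for left-invariant fields identifies the right-hand
   side with < xi' + nabla^g_xi xi, eta > when xi is horizontal.

   The action of G on H is only known to be induced by pi; its differentials
   exist because pi is a submersion: a contraction argument shows that pi has
   local right inverses with linear error control.

   Two horizontal lifts of q satisfy A(x1) xi1 = A(x2) xi2 with A Lipschitz and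
   injective on horizontal vectors, so that they agree by a Gronwall
   argument. *)
Require Import Defs.
From HB Require Import structures.
From mathcomp Require Import all_boot all_order all_algebra.
From mathcomp Require Import all_classical all_reals all_analysis.
From mathcomp Require Import ring lra.
Set Implicit Arguments.
Unset Strict Implicit.
Unset Printing Implicit Defensive.
Import Order.TTheory GRing.Theory Num.Theory.
Import numFieldNormedType.Exports.
Local Open Scope classical_set_scope.
Local Open Scope ring_scope.

(** * Differential calculus in normed modules *)

(** Only the diagonal terms [nabla_u u] occur, so two metric identities and one commutation replace
    the full Koszul formula. Since [A] is onto, pairing with every [A eta] determines the
    acceleration. Translating by [g(t0)^-1] brings the curve to [1], so that a single chart of [G]
    and a single frame serve all base points. The submersion preserves the pairing of a horizontal
    vector with an arbitrary one. Hence [eta] ranges over the whole Lie algebra, and brackets, which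
    may have a vertical part, cause no trouble as long as they are paired with [xi]. The term in
    [xi'] is treated the same way: the derivative of a curve in [d] stays in [d], so it is
    horizontal too. Regularity shapes the uniqueness argument. A competing lift has a velocity at
    each time, one-sided at the endpoints, with no continuity in time. Gronwall's inequality is
    therefore derived from the mean value theorem instead of an integral, and the trivialised
    velocity of the competitor is controlled through that of [g], which is continuous. *)

Section Calculus.
Context {R : realType}.

(** The candidate [df] is a bare function, so a derivative can be exhibited before any linear
    structure is attached to it; uniqueness of the differential then identifies it with ['d f x]. *)
Lemma is_diffP (V W : normedModType R) (f : V -> W) (x : V) (df : V -> W) :
  is_diff x f df <->
  [/\ linear df, continuous df &
    forall e, 0 < e -> \forall h \near 0,
      `|f (h + x) - f x - df h| <= e * `|h|].
Proof.
split=> [[dfx <-]|[lin cdf df_]].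
  split=> [|?|e e0]; [exact: linearP|exact: diff_continuous|].
  have /diff_locally/eqaddoP/(_ e e0) := dfx.
  by apply: filterS => h /=; rewrite !fctE /= opprD addrA.
pose dfM := GRing.isLinear.Build _ _ _ _ _ lin.
pose dfL : {linear V -> W} := HB.pack df dfM.
have E : f \o shift x = cst (f x) + (dfL : V -> W) +o_ 0 id.
  apply/eqaddoP => e e0; have := df_ e e0.
  by apply: filterS => h /=; rewrite !fctE /= opprD addrA.
have dE : 'd f x = dfL :> (V -> W) by apply: diff_unique.
split; last exact: dE.
by apply/diff_locallyP; split; rewrite dE.
Qed.

Lemma is_diff_unique (V W : normedModType R) (f : V -> W) (x : V)
    (df df' : V -> W) :
  is_diff x f df -> is_diff x f df' -> df = df'.
Proof. by case=> _ <- [_ <-]. Qed.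

Lemma is_diff_near (V W : normedModType R) (f g : V -> W) (x : V)
    (df : V -> W) :
  {near x, f =1 g} -> is_diff x f df -> is_diff x g df.
Proof.
move=> fg /is_diffP[lin cdf dfx]; apply/is_diffP; split=> // e e0.
have fgx : f x = g x := nbhs_singleton fg.
have fgh : \forall h \near 0, f (h + x) = g (h + x).
  by move: fg; rewrite [in X in X -> _](near_shift 0) subr0.
by apply: filterS2 fgh (dfx e e0) => h <-; rewrite fgx.
Qed.

Lemma differentiable_near (V W : normedModType R) (f g : V -> W) (x : V) :
  {near x, f =1 g} -> differentiable f x -> differentiable g x.
Proof. by move=> fg /differentiableP/(is_diff_near fg)[]. Qed.

Lemma near_eq_diff (V W : normedModType R) (f g : V -> W) (x : V) :
  {near x, f =1 g} -> differentiable f x -> 'd f x = 'd g x :> (V -> W).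
Proof. by move=> fg /differentiableP/(is_diff_near fg)[_ ->]. Qed.

Lemma rV_delta n (w : 'rV[R]_n) : w = \sum_i w 0 i *: delta_mx 0 i.
Proof. exact: row_sum_delta. Qed.

Lemma is_diff_coord (V : normedModType R) n (f df : V -> 'rV[R]_n) x i :
  is_diff x f df -> is_diff x (fun y => f y 0 i : R^o) (fun v => df v 0 i).
Proof.
move=> dfx; pose c := fun w : 'rV[R]_n => w 0 i : R^o.
have lin : linear c by move=> k u v; rewrite /c !mxE.
pose cM := GRing.isLinear.Build _ _ _ _ _ lin.
pose cL : {linear 'rV[R]_n -> R^o} := HB.pack c cM.
have cc : continuous cL by apply: coord_continuous.
have dc : is_diff (f x) cL c.
  by apply: DiffDef; [apply: linear_differentiable|apply: diff_lin].
exact: (is_diff_comp dfx dc).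
Qed.

Lemma is_diff_scale (V W : normedModType R) (k : V -> R^o) (f : V -> W) x
    (dk : V -> R^o) df :
  is_diff x k dk -> is_diff x f df ->
  is_diff x (fun y => k y *: f y) (fun v => k x *: df v + dk v *: f x).
Proof.
move=> dkx dfx.
have bil : bilinear_for (GRing.Scale.Law.clone _ _ *:%R _)
    (GRing.Scale.Law.clone _ _ *:%R _) ( *:%R : R^o -> W -> W).
  split=> [u'|u] a y z /=; first by rewrite scalerDl scalerA.
  by rewrite scalerDr !scalerA mulrC.
pose sB := bilinear_isBilinear.Build R R^o W W _ _ _ bil.
pose s : {bilinear R^o -> W -> W} := HB.pack ( *:%R : R^o -> W -> W) sB.
have sc : continuous (fun p : R^o * W => s p.1 p.2).
  by move=> p; apply: scale_continuous.
have ds : is_diff (k x, f x) (fun p : R^o * W => s p.1 p.2)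
    (fun q => s (k x) q.2 + s q.1 (f x)).
  by apply: DiffDef; [apply: differentiable_bilin|rewrite diff_bilin].
exact: (is_diff_comp (is_diff_pair dkx dfx) ds).
Qed.

Lemma is_diff_sum (V W : normedModType R) n (f df : 'I_n -> V -> W) x :
  (forall i, is_diff x (f i) (df i)) ->
  is_diff x (fun y => \sum_i f i y) (fun v => \sum_i df i v).
Proof.
move=> dfx.
have -> : (fun y => \sum_i f i y) = \sum_i f i.
  by apply/funext => y; rewrite fct_sumE.
have -> : (fun y => \sum_i df i y) = \sum_i df i.
  by apply/funext => y; rewrite fct_sumE.
elim/big_rec2: _ => [|i g h _ dgh]; first exact: is_diff_cst.
exact: is_diffD.
Qed.

(** Expanding the vector in the standard basis turns [b] into a finite sum of scalars times
    differentiable maps, so partial differentiability in [y] is enough. Uniqueness of differentials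
    makes [b'] linear in its first argument, which puts the sum back together. *)
Lemma is_diff_joint (V W : normedModType R) n (b : V -> 'rV[R]_n -> W)
    (b' : 'rV[R]_n -> V -> W) x w :
  (forall y, linear (b y)) -> (forall u, is_diff x (b ^~ u) (b' u)) ->
  is_diff (x, w) (fun z : V * 'rV[R]_n => b z.1 z.2)
    (fun z => b' w z.1 + b x z.2).
Proof.
move=> lin db.
have bE y u : b y u = \sum_i u 0 i *: b y (delta_mx 0 i).
  pose bM := GRing.isLinear.Build _ _ _ _ _ (lin y).
  pose bL : {linear 'rV[R]_n -> W} := HB.pack (b y) bM.
  rewrite [in LHS](rV_delta u) -[b y]/(bL : _ -> _) linear_sum.
  by apply: eq_bigr => i _; rewrite linearZ.
have b'E v u : b' u v = \sum_i u 0 i *: b' (delta_mx 0 i) v.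
  have := is_diff_sum (fun i : 'I_n => is_diff_scale
      (is_diff_cst (u 0 i : R^o) x) (db (delta_mx 0 i))).
  under eq_fun do rewrite -bE.
  move/(is_diff_unique (db u)) => ->; apply: eq_bigr => i _.
  by rewrite scale0r addr0.
have d2 : is_diff (x, w) (snd : V * 'rV[R]_n -> _) snd.
  apply/is_diffP; split=> [k y z||e e0] //; first by move=> ?; apply: cvg_snd.
  by near=> h; rewrite /= addrK subrr normr0 mulr_ge0// ltW.
have d1 : is_diff (x, w) (fst : V * 'rV[R]_n -> _) fst.
  apply/is_diffP; split=> [k y z||e e0] //; first by move=> ?; apply: cvg_fst.
  by near=> h; rewrite /= addrK subrr normr0 mulr_ge0// ltW.
under [X in is_diff _ X _]eq_fun do rewrite bE.
have dbi i : is_diff (x, w) (fun z : V * 'rV[R]_n => b z.1 (delta_mx 0 i))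
    (fun z => b' (delta_mx 0 i) z.1).
  exact: (is_diff_comp d1 (db (delta_mx 0 i))).
have := is_diff_sum (fun i => is_diff_scale (is_diff_coord i d2) (dbi i)).
move/is_diff_eq; apply; apply/funext => z /=.
by rewrite big_split/= -b'E -bE.
Unshelve. all: by end_near. Qed.

End Calculus.

(** * Mean value inequalities, symmetry of second derivatives, fixed points *)

Section MeanValue.
Context {R : realType}.

Lemma nbhs_distP (V : normedModType R) (x : V) (P : set V) :
  (\forall y \near x, P y) <-> exists2 d, 0 < d & forall y, `|y - x| < d -> P y.
Proof.
rewrite (nbhs_normP x P); split=> -[d d0 dP]; exists d => //.
  by move=> y yd; apply: dP; rewrite /= distrC.
by move=> y; rewrite /= distrC => yd; apply: dP.
Qed.

Lemma nbhs0P (V : normedModType R) (P : set V) :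
  (\forall y \near 0, P y) <-> exists2 d, 0 < d & forall y, `|y| < d -> P y.
Proof.
rewrite nbhs_distP; split=> -[d d0 dP]; exists d => // y.
  by move=> yd; apply: dP; rewrite subr0.
by rewrite subr0; apply: dP.
Qed.

Lemma rV_normP n (w : 'rV[R]_n) (e : R) :
  0 <= e -> (`|w| <= e <-> forall i, `|w 0 i| <= e).
Proof.
move=> e0; rewrite [in X in X <-> _]/Num.norm/= mx_normrE; split.
  move=> we i; apply: le_trans we.
  exact: (le_bigmax _ (fun i => `|w i.1 i.2|) (0, i)).
by move=> we; apply: bigmax_le => // -[i j] _ /=; rewrite ord1.
Qed.

Lemma ler_coord_norm n (w : 'rV[R]_n) i : `|w 0 i| <= `|w|.
Proof. by have /rV_normP : `|w| <= `|w| by []; apply. Qed.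

(** In finite dimension pointwise smallness is uniform on the unit ball: each basis vector gets a
    share of [e]. Dividing by [n.+1] also covers [n = 0]. *)
Lemma near_linear_bound T (F : set_system T) (FF : Filter F) n
    (W : normedModType R) (A : T -> 'rV[R]_n -> W) :
  (forall t, linear (A t)) ->
  (forall w e, 0 < e -> \forall t \near F, `|A t w| <= e) ->
  forall e, 0 < e -> \forall t \near F, forall w, `|A t w| <= e * `|w|.
Proof.
move=> lin A0 e e0; have n0 : 0 < e / n.+1%:R by rewrite divr_gt0.
have /filter_forall H : forall i, \forall t \near F,
  `|A t (delta_mx 0 i)| <= e / n.+1%:R by move=> i; exact: A0.
apply: filterS H => t At w.
pose bM := GRing.isLinear.Build _ _ _ _ _ (lin t).
pose bL : {linear 'rV[R]_n -> W} := HB.pack (A t) bM.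
rewrite [in leLHS](rV_delta w) -[A t]/(bL : _ -> _) linear_sum.
apply: (le_trans (ler_norm_sum _ _ _)).
apply: (@le_trans _ _ (\sum_(i < n) `|w| * (e / n.+1%:R))).
  apply: ler_sum => i _; rewrite linearZ normrZ ler_pM//; last exact: At.
  exact: ler_coord_norm.
rewrite sumr_const card_ord -[X in X <= _]mulr_natr -!mulrA mulrC ler_wpM2r//.
by rewrite ger_pMr// mulrC ler_pdivrMr// mul1r ler_nat.
Qed.

Lemma mean_value (V : normedModType R) (f : V -> R^o) x v (df : R -> V -> R^o) :
  (forall t, 0 <= t <= 1 -> is_diff (x + t *: v) f (df t)) ->
  exists2 c, 0 < c < 1 & f (x + v) - f x = df c v.
Proof.
move=> dfx; pose h (t : R) : R^o := f (x + t *: v).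
have dh (t : R) : 0 <= t <= 1 -> is_diff t h (fun s => df t (s *: v)).
  move=> t01.
  have d1 : is_diff t (fun s : R => x + s *: v) (fun s => s *: v).
    have := is_diffD (is_diff_cst x t) (is_diff_scalel t v).
    by move/is_diff_eq; apply; apply/funext => s; rewrite !fctE add0r.
  exact: (is_diff_comp d1 (dfx t t01)).
have dh' (t : R) : 0 <= t <= 1 -> is_derive t 1 h (df t v).
  move=> /dh[h1 h2]; split; first exact/derivable1_diffP.
  by rewrite deriveE// h2 scale1r.
have [||c c01] := @MVT R h (df ^~ v) 0 1 ltr01.
- by move=> t; rewrite in_itv /= => /andP[t0 t1]; apply: dh'; rewrite !ltW.
- apply: derivable_within_continuous => t; rewrite in_itv /= => t01.
  by have [] := dh' _ t01.
rewrite /h scale1r scale0r addr0 subr0 mulr1 => E.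
by exists c => //; move: c01; rewrite in_itv.
Qed.

(** The norm of a row vector is the maximum of its coordinates. The scalar theorem applied to each
    coordinate therefore loses no constant, although the intermediate point varies with the
    coordinate. *)
Lemma mean_value_le (V : normedModType R) n (f : V -> 'rV[R]_n) x v M :
  0 <= M ->
  (forall t, 0 <= t <= 1 -> differentiable f (x + t *: v) /\
    `|'d f (x + t *: v) v| <= M) ->
  `|f (x + v) - f x| <= M.
Proof.
move=> M0 dfx; apply/rV_normP => // i.
have [t t01|c /andP[c0 c1]] := @mean_value V (fun y => f y 0 i) x v
    (fun t u => 'd f (x + t *: v) u 0 i).
  by have [/differentiableP dt _] := dfx t t01; exact: is_diff_coord.
rewrite !mxE => ->; apply: (le_trans (ler_coord_norm _ _)).
by have [|_] := dfx c; rewrite ?(ltW c0) ?(ltW c1).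
Qed.

Lemma is_diff_shift (V W : normedModType R) (f : V -> W) a x df :
  is_diff (a + x) f df -> is_diff x (fun y => f (a + y)) df.
Proof.
move=> /is_diffP[lin cdf dfx]; apply/is_diffP; split=> // e e0.
by apply: filterS (dfx e e0) => h; rewrite addrCA.
Qed.

(** The mean value theorem for [y |-> f (s *: w + y) - f y] along [s *: v] turns the second
    difference into [s] times a first difference of ['d f _ v], taken at the offsets
    [h1 = c *: (s *: v) + s *: w] and [h2 = c *: (s *: v)]. Expanding at [x] for both offsets gives
    the two error terms, of sizes [s * (|v| + |w|)] and [s * |v|]. *)
Lemma second_difference (V : normedModType R) (f : V -> R^o) x v w Dv e :
  (\forall y \near x, differentiable f y) ->
  is_diff x (fun y => 'd f y v : R^o) Dv -> 0 < e ->
  \forall s \near 0^'+,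
    `|f (x + s *: v + s *: w) - f (x + s *: v) - f (x + s *: w) + f x
      - s ^+ 2 * Dv w| <= e * s ^+ 2 * (`|v| + `|w| + `|v|).
Proof.
move=> /nbhs_distP[d1 d10 dfx] /is_diffP[lin cdf dDv] e0.
have /nbhs0P[d2 d20 {}dDv] := dDv e e0.
near=> s.
have s0 : 0 < s by near: s; exact: nbhs_right_gt.
have [svw1 svw2] : s * (`|v| + `|w|) < d1 /\ s * (`|v| + `|w|) < d2.
  have b0 : 0 < `|v| + `|w| + 1 by rewrite ltr_wpDl// addr_ge0.
  have H : s * (`|v| + `|w| + 1) < Num.min d1 d2.
    rewrite -ltr_pdivlMr//; near: s; apply: nbhs_right_lt.
    by rewrite divr_gt0// lt_min d10.
  move: H; rewrite lt_min => /andP[H1 H2]; split.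
    by apply: le_lt_trans H1; rewrite ler_pM2l// lerDl.
  by apply: le_lt_trans H2; rewrite ler_pM2l// lerDl.
have Hn t : 0 <= t <= 1 -> `|t *: (s *: v) + s *: w| <= s * (`|v| + `|w|) /\
    `|t *: (s *: v)| <= s * `|v|.
  move=> /andP[t0 t1].
  have H : `|t *: (s *: v)| <= s * `|v|.
    by rewrite !normrZ !ger0_norm ?(ltW s0)// ler_piMl// mulr_ge0// ltW.
  split=> //; rewrite mulrDr (le_trans (ler_normD _ _))// lerD// normrZ.
  by rewrite ger0_norm ?(ltW s0).
have swd t : 0 <= t <= 1 -> `|t *: (s *: v)| <= s * (`|v| + `|w|).
  move=> /Hn[_ H]; apply: le_trans H _.
  by rewrite mulrDr lerDl mulr_ge0// ltW.
have [t t01|c /andP[/ltW c0 /ltW c1]] := @mean_value V (fun y => f (s *: w + y) - f y) x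
    (s *: v) (fun t u => 'd f (s *: w + (x + t *: (s *: v))) u
                         - 'd f (x + t *: (s *: v)) u).
  apply: is_diffB; [apply: is_diff_shift|]; apply: differentiableP; apply: dfx.
    rewrite addrCA addrC addrK addrC; apply: le_lt_trans svw1.
    by have [] := Hn t t01.
  by rewrite addrC addKr; apply: le_lt_trans svw1; exact: swd.
have {}c1 : 0 <= c <= 1 by rewrite c0.
have -> : f (x + s *: v + s *: w) - f (x + s *: v) - f (x + s *: w) + f x
   = f (s *: w + (x + s *: v)) - f (x + s *: v) - (f (s *: w + x) - f x).
  by rewrite opprB addrA addrAC [s *: w + _]addrC [s *: w + _]addrC.
move=> ->; set F := fun y => 'd f y v : R^o.
have [Hn1 Hn2] := Hn c c1.
have {swd}Hn3 := swd c c1.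
set h2 := c *: (s *: v) in Hn1 Hn2 Hn3 *; set h1 := h2 + s *: w in Hn1.
have -> : s *: w + (x + h2) = h1 + x.
  by rewrite /h1 addrC [x + h2]addrC addrAC.
rewrite [x + h2]addrC.
have E1 : `|F (h1 + x) - F x - Dv h1| <= e * `|h1|.
  exact/dDv/(le_lt_trans Hn1 svw2).
have E2 : `|F (h2 + x) - F x - Dv h2| <= e * `|h2|.
  exact/dDv/(le_lt_trans Hn3 svw2).
pose DvM := GRing.isLinear.Build _ _ _ _ _ lin.
pose DvL : {linear V -> R^o} := HB.pack Dv DvM.
have DvD : Dv h1 = Dv h2 + s * Dv w.
  by rewrite -[Dv]/(DvL : _ -> _) linearD; congr (_ + _); rewrite linearZ.
have FE y : 'd f y (s *: v) = s * F y by rewrite linearZ.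
rewrite !FE.
have -> : s * F (h1 + x) - s * F (h2 + x) - s ^+ 2 * Dv w =
  s * ((F (h1 + x) - F x - Dv h1) - (F (h2 + x) - F x - Dv h2)).
  by rewrite DvD; ring.
rewrite normrM ger0_norm ?(ltW s0)//.
have -> : e * s ^+ 2 * (`|v| + `|w| + `|v|) =
    s * (e * (s * (`|v| + `|w|)) + e * (s * `|v|)) by ring.
rewrite ler_pM2l// (le_trans (ler_normB _ _))// lerD//.
  by rewrite (le_trans E1)// ler_pM2l.
by rewrite (le_trans E2)// ler_pM2l.
Unshelve. all: by end_near. Qed.

(** The second difference is symmetric in [v] and [w], and divided by [s ^+ 2] it tends both to
    [Dv w] and to [Dw v]. The tolerance is divided by [C + 1] because [C] vanishes for
    [v = w = 0]. *)
Lemma diff_diff_sym (V : normedModType R) (f : V -> R^o) x v w Dv Dw :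
  (\forall y \near x, differentiable f y) ->
  is_diff x (fun y => 'd f y v : R^o) Dv ->
  is_diff x (fun y => 'd f y w : R^o) Dw -> Dv w = Dw v.
Proof.
move=> dfx dv dw; apply/eqP; rewrite -subr_eq0 -normr_le0.
set C := (`|v| + `|w| + `|v|) + (`|w| + `|v| + `|w|).
have C0 : 0 <= C by rewrite /C !addr_ge0.
have C1 : 0 < C + 1 by rewrite ltr_wpDl.
apply/ler_addgt0Pl => e e0; rewrite addr0.
have eC : 0 < e / (C + 1) by rewrite divr_gt0.
near (0 : R)^'+ => s.
have s0 : 0 < s by near: s; exact: nbhs_right_gt.
have s20 : 0 < s ^+ 2 by rewrite exprn_gt0.
have H1 : `|f (x + s *: v + s *: w) - f (x + s *: v) - f (x + s *: w) + f x
      - s ^+ 2 * Dv w| <= e / (C + 1) * s ^+ 2 * (`|v| + `|w| + `|v|).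
  by near: s; exact: second_difference.
have H2 : `|f (x + s *: w + s *: v) - f (x + s *: w) - f (x + s *: v) + f x
      - s ^+ 2 * Dw v| <= e / (C + 1) * s ^+ 2 * (`|w| + `|v| + `|w|).
  by near: s; exact: second_difference.
rewrite -(ler_pM2l s20) -[X in X * `|_|]ger0_norm ?(ltW s20)// -normrM.
have -> : s ^+ 2 * (Dv w - Dw v) =
  (f (x + s *: w + s *: v) - f (x + s *: w) - f (x + s *: v) + f x
      - s ^+ 2 * Dw v) -
  (f (x + s *: v + s *: w) - f (x + s *: v) - f (x + s *: w) + f x
      - s ^+ 2 * Dv w).
  by rewrite [x + s *: w + _]addrAC; ring.
rewrite (le_trans (ler_normB _ _))// (le_trans (lerD H2 H1))// -mulrDr.
rewrite [X in _ * X]addrC -/C mulrAC mulrC ler_pM2l//.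
by rewrite mulrAC ler_pdivrMr// ler_pM2l// lerDl.
Unshelve. all: by end_near. Qed.

Lemma fixed_point_rV n (g : 'rV[R]_n -> 'rV[R]_n) r : 0 <= r ->
  (forall z, `|z| <= r -> `|g z| <= r) ->
  (forall z z', `|z| <= r -> `|z'| <= r -> `|g z - g z'| <= 2^-1 * `|z - z'|) ->
  exists2 z, `|z| <= r & g z = z.
Proof.
move=> r0 gr gl.
pose X : completeNormedModType R := HB.pack 'rV[R]_n.
pose U : set X := [set z : 'rV[R]_n | `|z| <= r].
have Ug : set_fun U U (g : X -> X) by move=> z; apply: gr.
pose gM := isFun.Build _ _ U U (g : X -> X) Ug.
pose gF : {fun U >-> U} := HB.pack (g : X -> X) gM.
have cg : is_contraction gF.
  exists 2^-1%:nng; split; first by rewrite /= invf_lt1// ltr1n.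
  by move=> [z z'] [/= zU z'U]; exact: gl.
have cU : closed U.
  have -> : U = (fun z : X => `|z|) @^-1` [set t : R | t <= r] by [].
  by apply: closed_comp => [z _|]; [exact: norm_continuous|exact: closed_le].
have [|z zU zg] := banach_fixed_point cg cU.
  by exists 0; rewrite /U /= normr0.
by exists z.
Qed.

End MeanValue.

(** * Submersions: local right inverses and factorisation *)

Section LocalSurjection.
Context {R : realType}.

Lemma linear_at0 (V W : normedModType R) (S : V -> W) : linear S -> S 0 = 0.
Proof.
by move=> lin; have := lin (-1) 0 0; rewrite scaler0 addr0 scaleN1r addNr.
Qed.

Lemma is_diff_affine (V W : normedModType R) (S : V -> W) a z :
  linear S -> continuous S -> is_diff z (fun y => a + S y) S.
Proof.
move=> lin cS; apply/is_diffP; split=> // e e0.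
pose SM := GRing.isLinear.Build _ _ _ _ _ lin.
pose SL : {linear V -> W} := HB.pack S SM.
near=> h; rewrite -[S]/(SL : _ -> _) linearD addrCA addrK subrr normr0.
by rewrite mulr_ge0// ltW.
Unshelve. all: by end_near. Qed.

Lemma is_diff_linear (V W : normedModType R) (S : V -> W) z :
  linear S -> continuous S -> is_diff z S S.
Proof.
move=> lin cS; have := is_diff_affine 0 z lin cS.
by under eq_fun do rewrite add0r.
Qed.

Lemma linear_rV_continuous n (W : normedModType R) (S : 'rV[R]_n -> W) :
  linear S -> continuous S.
Proof.
move=> lin x; suff [dS _] : is_diff x S S.
  exact: differentiable_continuous.
have := is_diff_sum (fun i : 'I_n => is_diff_scale
  (is_diff_coord i (is_diff_id x)) (is_diff_cst (S (delta_mx 0 i)) x)).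
pose SM := GRing.isLinear.Build _ _ _ _ _ lin.
pose SL : {linear 'rV[R]_n -> W} := HB.pack S SM.
have SE u : S u = \sum_i u 0 i *: S (delta_mx 0 i).
  rewrite [in LHS](rV_delta u) -[S]/(SL : _ -> _) linear_sum.
  by apply: eq_bigr => i _; rewrite linearZ.
rewrite (_ : (fun y => _) = S); last by apply/funext => u; rewrite SE.
move/is_diff_eq; apply; apply/funext => u; rewrite [RHS]SE.
by apply: eq_bigr => i _; rewrite scaler0 add0r.
Qed.

(** The equation [f (x + S z) = y] says that [z] is a fixed point of [z |-> y - e z], where
    [e z = f (x + S z) - z] has small differential near [0] because [S] is a right inverse of
    ['d f x]. This map is a contraction of ratio 1/2. It preserves the ball of radius
    [r = 2 * |y - f x|]: half of [r] comes from [y - f x], half from the variation of [e]. *)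
Lemma local_surjection (V : normedModType R) n (f : V -> 'rV[R]_n) x
    (S : 'rV[R]_n -> V) :
  linear S ->
  (\forall y \near x, differentiable f y) ->
  (forall v, {for x, continuous (fun y => 'd f y v)}) ->
  (forall w, 'd f x (S w) = w) ->
  \forall y \near f x, exists2 z, f (x + S z) = y & `|z| <= 2 * `|y - f x|.
Proof.
move=> lin dfx cf SK; have cS := linear_rV_continuous lin.
have dS z := is_diff_affine x z lin cS.
have S0 := linear_at0 lin.
have xS : (fun z => x + S z) @ nbhs (0 : 'rV[R]_n) --> x.
  by rewrite -[X in _ --> X]addr0 -S0; apply: cvgD; [exact: cvg_cst|exact: cS].
pose A z w := 'd f (x + S z) (S w) - w.
have linA z : linear (A z).
  move=> k u v; rewrite /A lin linearD linearZ /= scalerBr opprD.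
  by rewrite addrACA.
have A0 w e : 0 < e -> \forall z \near (0 : 'rV[R]_n), `|A z w| <= e.
  move=> e0; have H := cvg_comp _ _ xS (cf (S w)).
  move/cvgrPdist_le : H => /(_ _ e0); apply: filterS => z.
  by rewrite /A SK distrC.
have h0 : 0 < 2^-1 :> R by rewrite invr_gt0.
have [d1 d10 HA] : exists2 d, 0 < d &
    forall z, `|z| < d -> forall w, `|A z w| <= 2^-1 * `|w|.
  apply/nbhs0P.
  have := near_linear_bound (@nbhs_filter _ (0 : 'rV[R]_n)) linA A0 h0; exact.
have [d2 d20 Hd] : exists2 d, 0 < d &
    forall z, `|z| < d -> differentiable f (x + S z).
  by apply/nbhs0P; have := xS _ dfx; exact.
pose d := Num.min d1 d2.
have d0 : 0 < d by rewrite lt_min d10.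
apply/nbhs_distP; exists (d / 2); first by rewrite divr_gt0.
move=> y yd; set r := 2 * `|y - f x|.
have rd : r < d by rewrite /r mulrC -ltr_pdivlMr.
pose e z : 'rV[R]_n := f (x + S z) - z.
have el z z' : `|z| <= r -> `|z'| <= r -> `|e z' - e z| <= 2^-1 * `|z' - z|.
  move=> zr z'r; rewrite -[in e z'](subrK z z') [z' - z + _]addrC.
  apply: mean_value_le => [|t /andP[t0 t1]]; first by rewrite mulr_ge0// ltW.
  set u := z + _; have ud : `|u| < d.
    apply: le_lt_trans rd; rewrite /u.
    have -> : z + t *: (z' - z) = (1 - t) *: z + t *: z'.
      by rewrite scalerBr scalerBl scale1r addrA addrAC.
    rewrite (le_trans (ler_normD _ _))// !normrZ.
    rewrite !ger0_norm ?subr_ge0//.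
    have -> : r = (1 - t) * r + t * r by ring.
    by rewrite lerD// ler_wpM2l// subr_ge0.
  move: ud; rewrite lt_min => /andP[ud1 ud2].
  have de : is_diff u e (A u).
    apply: is_diffB.
    exact: (is_diff_comp (dS u) (differentiableP (Hd u ud2))).
  case: de => de dE; split => //; rewrite dE.
  exact: HA.
have [|||z zr zE] := @fixed_point_rV R n (fun z => y - e z) r.
- by rewrite /r mulr_ge0.
- move=> z zr; have := el 0 z; rewrite normr0 subr0 => H.
  have -> : y - e z = y - f x - (e z - e 0).
    by rewrite /e S0 addr0 subr0 [in RHS]opprB addrA subrK.
  rewrite (le_trans (ler_normB _ _))//.
  have -> : r = `|y - f x| + 2^-1 * r by rewrite /r mulKf// mulr2n mulrDl mul1r.
  rewrite lerD2l (le_trans (H _ _))//; first by rewrite mulr_ge0.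
  by rewrite ler_pM2l.
- move=> z z' zr z'r.
  have aux (p q s : 'rV[R]_n) : p - q - (p - s) = s - q.
    by rewrite opprB addrC addrA subrK.
  by rewrite aux [`|z - z'|]distrC; exact: el.
exists z => //; move: zE; rewrite /e opprB addrA => /eqP.
by rewrite subr_eq [y + z]addrC => /eqP/addrI->.
Qed.

(* [F] is only constrained on the image of [f], which is a neighbourhood of
   [f x] because [f] is a submersion at [x]. *)
Lemma differentiable_factor (V W : normedModType R) n (f : V -> 'rV[R]_n)
    (F : 'rV[R]_n -> W) x :
  (\forall y \near x, differentiable f y) ->
  (forall v, {for x, continuous (fun y => 'd f y v)}) ->
  (forall w, exists v, 'd f x v = w) ->
  differentiable (F \o f) x -> differentiable F (f x).
Proof.
move=> dfx cf surj dFf.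
have /choice[s sE] : forall i : 'I_n, exists v, 'd f x v = delta_mx 0 i.
  by move=> i; exact: surj.
pose S (w : 'rV[R]_n) := \sum_i w 0 i *: s i.
have linS : linear S.
  move=> k u v; rewrite /S scaler_sumr -big_split /=; apply: eq_bigr => i _.
  by rewrite !mxE scalerDl scalerA.
have SK w : 'd f x (S w) = w.
  rewrite linear_sum [RHS]rV_delta; apply: eq_bigr => i _.
  by rewrite linearZ /= sE.
have cS := linear_rV_continuous linS.
have dS := is_diff_affine x 0 linS cS.
have S0 := linear_at0 linS.
(* The only possible derivative of [F], by the chain rule along the right inverse [S]. *)
pose T := fun w => 'd (F \o f) x (S w).
have linT : linear T by move=> k u v; rewrite /T linS linearP.
have cT := linear_rV_continuous linT.
have df0 : differentiable f (x + S 0).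
  by rewrite S0 addr0; exact: (nbhs_singleton dfx).
have dFf0 : differentiable (F \o f) (x + S 0) by rewrite S0 addr0.
have /is_diffP[_ _ d1] := is_diff_comp dS (differentiableP df0).
have /is_diffP[_ _ d2] := is_diff_comp dS (differentiableP dFf0).
pose TM := GRing.isLinear.Build _ _ _ _ _ linT.
pose TL : {linear 'rV[R]_n -> W} := HB.pack T TM.
have [k k0 Tk] := @linear_lipschitz _ _ _ TL cT.
suff [] : is_diff (f x) F T by [].
apply/is_diffP; split=> // e e0.
(* With [f (x + S z) = f x + h] and [|z| <= 2 * |h|], the error is that of [F \o f] at [z] plus
   [T (z - h)], and [z - h] is minus the linearisation error of [f]. The bounds add up to
   [eta * 2 * |h| * (1 + k) = e * |h|]. *)
pose eta := e / (2 * (1 + k)).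
have k1 : 0 < 2 * (1 + k) by rewrite mulr_gt0// addr_gt0.
have eta0 : 0 < eta by rewrite divr_gt0.
have /nbhs0P[r1 r10 {}d1] := d1 eta eta0.
have /nbhs0P[r2 r20 {}d2] := d2 eta eta0.
have /nbhs_distP[r3 r30 ls] := local_surjection linS dfx cf SK.
apply/nbhs0P; exists (Num.min r3 (Num.min r1 r2 / 2)).
  by rewrite !lt_min r30 divr_gt0// lt_min r10.
move=> h; rewrite lt_min => /andP[hr3]; rewrite ltr_pdivlMr// lt_min.
move=> /andP[hr1 hr2].
have [|z zE] := ls (h + f x); first by rewrite addrK.
rewrite addrK mulrC => zh.
have := d1 z (le_lt_trans zh hr1); have := d2 z (le_lt_trans zh hr2).
rewrite !addr0 /= S0 addr0 zE addrK SK -/(T z) => H1 H2.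
have -> : F (h + f x) - F (f x) - T h = F (h + f x) - F (f x) - T z + TL (z - h).
  by rewrite linearB /= addrA subrK.
rewrite (le_trans (ler_normD _ _))//.
have -> : e * `|h| = eta * (`|h| * 2) + k * (eta * (`|h| * 2)).
  by rewrite /eta; field; rewrite gt_eqF// addr_gt0.
rewrite lerD//; first by rewrite (le_trans H1)// ler_pM2l.
rewrite (le_trans (Tk _))// ler_pM2l// -normrN opprB.
by rewrite (le_trans H2)// ler_pM2l.
Qed.

End LocalSurjection.

(** * One-sided derivatives of curves on an interval *)

Section DerivWithin.
Context {R : realType}.
Implicit Types I : set R.

(** Clearing the denominator makes the estimate true at [s = t] as well, so the punctured
    neighbourhood becomes a full one. *)
Lemma is_deriv_withinP (W : normedModType R) I (c : R -> W) t v :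
  is_deriv_within I c t v <->
  forall e, 0 < e -> \forall s \near t, I s ->
    `|c s - c t - (s - t) *: v| <= e * `|s - t|.
Proof.
have key s e : s != t ->
    (`|v - (s - t)^-1 *: (c s - c t)| <= e) =
    (`|c s - c t - (s - t) *: v| <= e * `|s - t|).
  rewrite -subr_eq0 => st; rewrite mulrC.
  have -> : c s - c t - (s - t) *: v =
      - ((s - t) *: (v - (s - t)^-1 *: (c s - c t))).
    by rewrite scalerBr scalerA divff// scale1r opprB.
  by rewrite normrN normrZ ler_pM2l// normr_gt0.
rewrite /is_deriv_within; split.
  move=> /cvgrPdist_le H e e0; have := H e e0.
  rewrite !near_withinE; apply: filterS => s H1 Is.
  have [->|st] := eqVneq s t; first by rewrite !subrr scale0r subr0 !normr0 mulr0.
  by rewrite -key//; exact: H1.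
move=> H; apply/cvgrPdist_le => e e0; have := H e e0.
rewrite !near_withinE; apply: filterS => s H1 st Is.
by rewrite key//; exact: H1.
Qed.

Lemma is_deriv_within_cvg (W : normedModType R) I (c : R -> W) t v :
  is_deriv_within I c t v -> c @ within I (nbhs t) --> c t.
Proof.
move=> /is_deriv_withinP dc; apply/cvgrPdist_le => e e0.
have v1 : 0 < `|v| + 1 by rewrite ltr_wpDl.
have ns : \forall s \near t, `|s - t| * (`|v| + 1) < e.
  apply/nbhs_distP; exists (e / (`|v| + 1)); first by rewrite divr_gt0.
  by move=> s; rewrite ltr_pdivlMr.
rewrite near_withinE; have := dc 1 ltr01.
apply: filterS2 ns => s se /[apply]; rewrite mul1r => H.
rewrite distrC; have -> : c s - c t = c s - c t - (s - t) *: v + (s - t) *: v.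
  by rewrite subrK.
rewrite (le_trans (ler_normD _ _))// (le_trans _ (ltW se))// mulrDr mulr1 addrC.
by rewrite lerD// normrZ.
Qed.

Lemma is_deriv_within_near (W : normedModType R) I (c c' : R -> W) t v :
  I t -> (\forall s \near t, I s -> c s = c' s) ->
  is_deriv_within I c t v -> is_deriv_within I c' t v.
Proof.
move=> It cc' /is_deriv_withinP dc; apply/is_deriv_withinP => e e0.
have <- := nbhs_singleton cc' It.
by have := dc e e0; apply: filterS2 cc' => s cs H Is; rewrite -cs//; exact: H.
Qed.

Lemma is_deriv_within_comp (V W : normedModType R) I (c : R -> V) t v
    (f df : V -> W) :
  is_diff (c t) f df -> is_deriv_within I c t v ->
  is_deriv_within I (f \o c) t (df v).
Proof.
move=> /is_diffP[lin cdf dfx] dc; have cc := is_deriv_within_cvg dc.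
move/is_deriv_withinP : dc => dc.
pose dfM := GRing.isLinear.Build _ _ _ _ _ lin.
pose dfL : {linear V -> W} := HB.pack df dfM.
have [k k0 Hk] := @linear_lipschitz _ _ _ dfL cdf.
apply/is_deriv_withinP => e e0.
have v1 : 0 < `|v| + 1 by rewrite ltr_wpDl.
(* Near [t] the increment of [c] is at most [(|v| + 1) * |s - t|]. Half of [e] pays for the
   remainder of [f] at that distance, half for the image under [df], of Lipschitz constant [k], of
   the remainder of [c]. *)
pose e1 := e / 2 / (`|v| + 1); pose e2 := e / 2 / k.
have e10 : 0 < e1 by rewrite !divr_gt0.
have e20 : 0 < e2 by rewrite !divr_gt0.
have /nbhs0P[r r0 {}dfx] := dfx e1 e10.
move/cvgrPdist_lt : cc => /(_ r r0); rewrite near_withinE => cc.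
apply: filterS3 cc (dc 1 ltr01) (dc e2 e20)  => s cs H1 H2 Is.
have {}cs := cs Is; have {}H1 := H1 Is; have {}H2 := H2 Is.
rewrite mul1r in H1.
have {}H1 : `|c s - c t| <= (`|v| + 1) * `|s - t|.
  rewrite -[c s - c t](subrK ((s - t) *: v)) (le_trans (ler_normD _ _))//.
  by rewrite mulrDl mul1r [leLHS]addrC lerD// normrZ mulrC.
rewrite distrC in cs; have {}dfx := dfx _ cs; rewrite subrK in dfx.
have -> : f (c s) - f (c t) - (s - t) *: df v =
  f (c s) - f (c t) - df (c s - c t) + dfL (c s - c t - (s - t) *: v).
  have -> : dfL (c s - c t - (s - t) *: v) = df (c s - c t) - (s - t) *: df v.
    by rewrite linearB linearZ.
  by rewrite addrA subrK.
rewrite (le_trans (ler_normD _ _))//.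
have -> : e * `|s - t| = e1 * ((`|v| + 1) * `|s - t|) + k * (e2 * `|s - t|).
  by rewrite /e1 /e2; field; rewrite !gt_eqF.
rewrite lerD//; first by rewrite (le_trans dfx)// ler_pM2l.
by rewrite (le_trans (Hk _))// ler_pM2l.
Qed.

Lemma is_deriv_within_pair (V W : normedModType R) I (c1 : R -> V) (c2 : R -> W)
    t v1 v2 :
  is_deriv_within I c1 t v1 -> is_deriv_within I c2 t v2 ->
  is_deriv_within I (fun s => (c1 s, c2 s)) t (v1, v2).
Proof.
move=> /is_deriv_withinP d1 /is_deriv_withinP d2; apply/is_deriv_withinP => e e0.
apply: filterS2 (d1 e e0) (d2 e e0) => s H1 H2 Is.
by rewrite prod_normE /= ge_max H1// H2.
Qed.

(** A nondegenerate interval has points other than [t] arbitrarily close to [t], on the right if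
    [t < b] and on the left otherwise. Uniqueness of one-sided derivatives rests on this. *)
Lemma itv_within_proper (a b t : R) : a < b -> t \in `[a, b] ->
  ProperFilter (within `[a, b]%classic t^').
Proof.
move=> ab; rewrite in_itv /= => /andP[at_ tb].
apply: Build_ProperFilter_ex => P HP.
have {HP}/nbhs_distP[d d0 HP] :
  \forall s \near t, s != t -> `[a, b]%classic s -> P s := HP.
have [tb'|bt] := ltP t b.
  have m0 : 0 < Num.min d (b - t) by rewrite lt_min d0 subr_gt0.
  exists (t + Num.min d (b - t) / 2); apply: HP.
  - rewrite addrC addKr ger0_norm ?divr_ge0 ?(ltW m0)//.
    by rewrite ltr_pdivrMr// (@le_lt_trans _ _ d) ?ge_min ?lexx// ltr_pMr ?ltr1n.
  - by rewrite -subr_eq0 addrC addKr gt_eqF// divr_gt0.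
  - rewrite /= in_itv /=; apply/andP; split.
      by rewrite (le_trans at_)// lerDl divr_ge0// ltW.
    rewrite -lerBrDl ler_pdivrMr// (@le_trans _ _ (b - t)) ?ge_min ?lexx ?orbT//.
    by rewrite ler_peMr ?ler1n// subr_ge0.
have ta : a < t by rewrite (lt_le_trans ab).
have m0 : 0 < Num.min d (t - a) by rewrite lt_min d0 subr_gt0.
exists (t - Num.min d (t - a) / 2); apply: HP.
- rewrite addrC addKr normrN ger0_norm ?divr_ge0 ?(ltW m0)//.
  by rewrite ltr_pdivrMr// (@le_lt_trans _ _ d) ?ge_min ?lexx// ltr_pMr ?ltr1n.
- by rewrite -subr_eq0 addrC addKr lt_eqF// oppr_lt0 divr_gt0.
- rewrite /= in_itv /=; apply/andP; split; last first.
    by rewrite (le_trans _ tb)// lerBlDr lerDl divr_ge0// ltW.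
  rewrite lerBrDr -lerBrDl ler_pdivrMr//.
  rewrite (@le_trans _ _ (t - a)) ?ge_min ?lexx ?orbT//.
  by rewrite ler_peMr ?ler1n// subr_ge0.
Qed.

Lemma is_deriv_within_unique (W : normedModType R) (a b : R) (c : R -> W) t v w :
  a < b -> t \in `[a, b] -> is_deriv_within `[a, b] c t v ->
  is_deriv_within `[a, b] c t w -> v = w.
Proof.
move=> ab tab dv dw; have FF := itv_within_proper ab tab.
exact: (cvg_unique _ dv dw).
Qed.

(* By the mean value theorem, the maximum of [`|y|] on [[t0, t1]] is at most
   [k * (t1 - t0)] times itself. *)
Lemma gronwall_zero n (a b t0 t1 k : R) (y dy : R -> 'rV[R]_n) :
  a <= t0 -> t0 <= t1 -> t1 <= b -> 0 <= k -> k * (t1 - t0) < 1 ->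
  (forall s, t0 <= s <= t1 -> is_deriv_within `[a, b] y s (dy s)) ->
  (forall s, t0 <= s <= t1 -> `|dy s| <= k * `|y s|) -> y t0 = 0 ->
  forall s, t0 <= s <= t1 -> y s = 0.
Proof.
move=> at0 t01 t1b k0 kt dY dyk y0.
have sub : `[t0, t1]%classic `<=` `[a, b]%classic.
  move=> s; rewrite /= !in_itv /= => /andP[h1 h2].
  by rewrite (le_trans at0 h1) (le_trans h2 t1b).
have ycvg s : t0 <= s <= t1 -> y @ within `[t0, t1]%classic (nbhs s) --> y s.
  move=> /dY/is_deriv_within_cvg; apply: cvg_trans; apply: cvg_app.
  exact: within_subset.
have [|m] := @EVT_max _ (fun s => `|y s|) _ _ t01.
  apply/subspace_continuousP => s; rewrite /= in_itv /= => /ycvg.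
  exact: cvg_norm.
rewrite in_itv /= => /andP[m0 m1] mmax.
suff ym : `|y m| <= 0.
  move=> s st; apply/eqP; rewrite -normr_le0.
  by apply: le_trans ym; apply: mmax; rewrite in_itv.
have {}kt : k * (m - t0) < 1.
  by apply: le_lt_trans kt; rewrite ler_wpM2l// lerB.
suff H : `|y m| <= k * (m - t0) * `|y m|.
  have [//|ym0] := leP `|y m| 0; move: H.
  by rewrite ler_pMl// leNgt kt.
have km0 : 0 <= k * (m - t0) * `|y m| by rewrite !mulr_ge0// subr_ge0.
apply/rV_normP => // i.
have [||c cm] := @MVT_segment R (fun s => y s 0 i) (fun s => dy s 0 i) t0 m m0.
- move=> s; rewrite in_itv /= => /andP[s0 sm].
  have st : t0 <= s <= t1 by rewrite !ltW// (lt_le_trans sm).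
  have ds : is_diff s (fun u => y u 0 i : R^o) (fun h : R^o => h *: (dy s 0 i : R^o)).
    apply/is_diffP; split=> [p q r|p|e e0].
    - by rewrite scalerDl scalerA.
    - exact: scalel_continuous.
    - have /is_deriv_withinP/(_ e e0) := dY s st.
      rewrite (near_shift 0) subr0.
      have : \forall h \near s, `[a, b]%classic h.
        have sab : s \in `]t0, t1[%R by rewrite in_itv /= s0 (lt_le_trans sm).
        have := near_in_itvoo sab; apply: filterS => h.
        rewrite in_itv /= => /andP[h1 h2].
        by apply: sub; rewrite /= in_itv /= !ltW.
      rewrite [X in X -> _](near_shift 0) subr0.
      apply: filterS2 => h /= hab /(_ hab); rewrite addrK => H.
      apply: le_trans H; apply: le_trans (ler_coord_norm _ i).
      by rewrite !mxE.
  case: ds => ds1 ds2; split; first exact/derivable1_diffP.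
  by rewrite deriveE// ds2 scale1r.
- apply/subspace_continuousP => s; rewrite /= in_itv /= => /andP[s0 sm].
  have st : t0 <= s <= t1 by rewrite s0 (le_trans sm).
  have cs : y @ within `[t0, m]%classic (nbhs s) --> y s.
    apply: cvg_trans (ycvg s st); apply: cvg_app; apply: within_subset.
    move=> u; rewrite /= !in_itv /= => /andP[-> um].
    exact: le_trans um m1.
  have H := cvg_comp _ _ cs (@coord_continuous R 1 n 0 i (y s)); exact: H.
rewrite y0 !mxE subr0 => ->; move: cm; rewrite in_itv /= => /andP[c0 cm].
have ct : t0 <= c <= t1 by rewrite c0 (le_trans cm).
rewrite normrM [`|m - t0|]ger0_norm ?subr_ge0// mulrAC ler_wpM2r ?subr_ge0//.
rewrite (le_trans (ler_coord_norm _ _))// (le_trans (dyk _ ct))// ler_wpM2l//.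
by apply: mmax; rewrite in_itv.
Qed.

End DerivWithin.

(** * Finite-dimensional linear algebra: representation of forms, bounds from injectivity *)

Section InnerProduct.
Context {R : realType} {n : nat}.

(** The Gram matrix of [B] in the standard basis is invertible, since a row [u] in its kernel
    satisfies [B u u = 0]. The representing vector solves the corresponding linear system. *)
Lemma riesz_rV (B : 'rV[R]_n -> 'rV[R]_n -> R) (phi : {linear 'rV[R]_n -> R^o}) :
  (forall k u v w, B (k *: u + v) w = k * B u w + B v w) ->
  (forall v w, B v w = B w v) -> (forall v, v != 0 -> 0 < B v v) ->
  exists w, forall v, B w v = phi v.
Proof.
move=> Blin Bsym Bpos.
pose M : 'M[R]_n := \matrix_(i, j) B (delta_mx 0 i) (delta_mx 0 j).
have B0 w : B 0 w = 0 by have := Blin (-1) 0 0 w; rewrite scaler0 addr0; lra.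
have BE u w : B u w = \sum_i u 0 i * B (delta_mx 0 i) w.
  rewrite [in LHS](rV_delta u).
  have Bsum r : B (\sum_(i <- r) u 0 i *: delta_mx 0 i) w =
      \sum_(i <- r) u 0 i * B (delta_mx 0 i) w.
    by elim: r => [|i r IH]; rewrite ?big_nil ?B0// !big_cons Blin IH.
  exact: Bsum.
have ME u j : (u *m M) 0 j = B u (delta_mx 0 j).
  by rewrite BE !mxE; apply: eq_bigr => i _; rewrite mxE.
have Mu : M \in unitmx.
  rewrite -row_free_unit -kermx_eq0; apply/eqP/row_matrixP => i; rewrite row0.
  set u := row i _; apply/eqP/negPn/negP => u0; have := Bpos _ u0.
  rewrite BE big1 ?ltxx// => j _.
  suff -> : B (delta_mx 0 j) u = 0 by rewrite mulr0.
  by rewrite Bsym -ME /u -row_mul mulmx_ker row0 mxE.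
exists ((\row_j phi (delta_mx 0 j)) *m invmx M) => v.
rewrite Bsym BE [in RHS](rV_delta v) linear_sum; apply: eq_bigr => j _.
by rewrite Bsym -ME mulmxKV// mxE linearZ.
Qed.

(** The restriction of [A] to [E] has a linear left inverse, and [k] is a Lipschitz constant of
    it. *)
Lemma injective_on_bound m (E : {vspace 'rV[R]_n}) (A : {linear 'rV[R]_n -> 'rV[R]_m}) :
  (forall v, v \in E -> A v = 0 -> v = 0) ->
  exists2 k, 0 < k & forall v, v \in E -> `|v| <= k * `|A v|.
Proof.
move=> inj; pose f : 'Hom(subvs_of E, 'rV[R]_m) := (linfun A \o linfun vsval)%VF.
have fE x : f x = A (vsval x) by rewrite lfunE /= !lfunE.
have kf : lker f == 0%VS.
  rewrite -subv0; apply/subvP => x; rewrite memv_ker fE => /eqP/inj.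
  by move=> /(_ (subvsP x)) x0; rewrite memv0; apply/eqP/val_inj.
pose S : {linear 'rV[R]_m -> 'rV[R]_n} := vsval \o f^-1%VF.
have cS : continuous S by apply: linear_rV_continuous => k u v; rewrite linearP.
have [k k0 Sk] := linear_lipschitz cS.
exists k => // v vE; have := Sk (A v).
by rewrite -[v in A v](vsprojK vE) -fE /= lker0_lfunK// !fE vsprojK.
Qed.

End InnerProduct.

(** * Smooth maps and tangent maps *)

Section SmoothNear.
Context {R : realType} {V W : normedModType R}.

Lemma Ck_eq (U : normedModType R) k (A : set U) (f g : U -> W) : open A ->
  (forall x, A x -> f x = g x) -> Ck k A f -> Ck k A g.
Proof.
move=> oA; elim: k f g => [|k IH] f g fg /=.
  move=> cf x Ax; have nfg : {near x, f =1 g}.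
    by have := open_nbhs_nbhs (conj oA Ax); apply: filterS => y /fg.
  move: (cf x Ax); rewrite /prop_for /continuous_at (fg x Ax) => cfx.
  by apply: cvg_trans cfx; exact: near_eq_cvg.
have nfg x : A x -> {near x, f =1 g}.
  by move=> Ax; have := open_nbhs_nbhs (conj oA Ax); apply: filterS => y /fg.
move=> [df cdf]; split=> [x Ax|v].
  exact: differentiable_near (nfg x Ax) (df x Ax).
apply: IH (cdf v) => x Ax.
by rewrite (near_eq_diff (nfg x Ax) (df x Ax)).
Qed.

(** The derivative of [f (a + S y)] along [v] has the same shape, with ['d f _ (S v)] in place of
    [f], so the induction closes in arbitrary normed modules. It serves to freeze one argument of
    the group multiplication, whose coordinate domain is a product. *)
Lemma Ck_affine (U : normedModType R) k (A : set V) (f : V -> W) (S : U -> V) a :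
  linear S -> continuous S -> Ck k A f -> open A ->
  Ck k ((fun y => a + S y) @^-1` A) (fun y => f (a + S y)).
Proof.
move=> lin cS + oA; elim: k f => [|k IH] f /=.
  move=> cf x Ax; have [/differentiable_continuous ca _] := is_diff_affine a x lin cS.
  exact: (continuous_comp ca (cf _ Ax)).
move=> [df cdf].
have dfa x : A (a + S x) ->
    is_diff x (fun y => f (a + S y)) (fun v => 'd f (a + S x) (S v)).
  move=> Ax.
  exact: (is_diff_comp (is_diff_affine a x lin cS) (differentiableP (df _ Ax))).
split=> [x Ax|v]; first by have [] := dfa x Ax.
apply: (@Ck_eq _ _ _ (fun y => 'd f (a + S y) (S v))) (IH _ (cdf (S v))).
  apply: open_comp => // x _.
  by have [/differentiable_continuous] := is_diff_affine a x lin cS.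
by move=> x /dfa[_ ->].
Qed.

Lemma smooth_near_affine (U : normedModType R) (f : V -> W) (S : U -> V) a x :
  linear S -> continuous S -> smooth_near f (a + S x) ->
  smooth_near (fun y => f (a + S y)) x.
Proof.
move=> lin cS [A [oA Ax fA]]; exists ((fun y => a + S y) @^-1` A); split=> //.
  apply: open_comp => // y _.
  by have [/differentiable_continuous] := is_diff_affine a y lin cS.
by move=> k; exact: Ck_affine.
Qed.

Lemma smooth_near_eq (U : normedModType R) (f g : U -> W) x :
  {near x, f =1 g} -> smooth_near f x -> smooth_near g x.
Proof.
rewrite /prop_near1 nbhsE => -[B [oB Bx] fg] [A [oA Ax fA]].
exists (A `&` B); split=> [||k]; [exact: openI|by []|].
apply: (@Ck_eq _ _ _ f); [exact: openI|by move=> y [_ /fg]|].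
elim: k (f) fA {fg} => [|k IH] h hA; first by move=> y [Ay _]; exact: (hA 0%N).
split=> [y [Ay _]|v]; first by have [+ _] := hA 1%N; apply.
by apply: IH => k'; have [_] := hA k'.+1; apply.
Qed.

Lemma smooth_near_cst (U : normedModType R) (a : W) (x : U) :
  smooth_near (cst a) x.
Proof.
exists setT; split=> // [|k]; first exact: openT.
elim: k a => [|k IH] a /=; first by move=> y _; exact: cst_continuous.
split=> [y _|v]; first exact: differentiable_cst.
suff -> : (fun y => 'd (cst a) y v) = cst 0 :> (U -> W) by exact: IH.
by apply/funext => y; rewrite diff_cst.
Qed.

End SmoothNear.

Section ManifoldCalculus.
Context {R : realType}.

(** The target is a normed module; a map into a manifold is first composed with the chart at its
    value. *)
Definition is_mdiff n (M : manifoldType R n) (W : normedModType R) (p : M)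
    (F : M -> W) (dF : 'rV[R]_n -> W) : Prop :=
  is_diff (chart p p) (F \o ichart p) dF.

Section OneManifold.
Context {n : nat} {M : manifoldType R n}.
Implicit Types p q : M.

Lemma near_dom p q : dom p q -> \forall r \near q, dom p r.
Proof. by move=> pq; apply: open_nbhs_nbhs; split; [exact: open_dom|]. Qed.

Lemma near_ichart p q (P : set M) : dom p q -> (\forall r \near q, P r) ->
  \forall x \near chart p q, P (ichart p x).
Proof.
move=> pq nP; have c : (chart p @` dom p) (chart p q) by exists q.
have H : ichart p @ nbhs (chart p q) --> q.
  by rewrite -[X in _ --> X](chartK _ _ pq); exact: continuous_ichart.
exact: (H _ nP).
Qed.

Lemma near_chart p q (P : set 'rV[R]_n) : dom p q ->
  (\forall x \near chart p q, P x) -> \forall r \near q, P (chart p r).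
Proof.
move=> pq nP; have H : chart p @ nbhs q --> chart p q :=
  continuous_chart _ _ pq.
exact: (H _ nP).
Qed.

Lemma near_ichartK p q : dom p q ->
  \forall x \near chart p q, chart p (ichart p x) = x.
Proof.
move=> pq; have : \forall x \near chart p q, (chart p @` dom p) x.
  by apply: open_nbhs_nbhs; split; [exact: open_chart|exists q].
by apply: filterS => _ [r pr <-]; rewrite chartK.
Qed.

Lemma is_mdiff_unique (W : normedModType R) p (F : M -> W) dF dF' :
  is_mdiff p F dF -> is_mdiff p F dF' -> dF = dF'.
Proof. exact: is_diff_unique. Qed.

Lemma is_diff_transition p q r : dom p r -> dom q r ->
  is_diff (chart p r) (chart q \o ichart p)
    ('d (chart q \o ichart p) (chart p r)).
Proof.
move=> pr qr; have [+ _] := smooth_transition p q 1.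
by move=> d1; apply/differentiableP/d1; exists r.
Qed.

Lemma is_mdiff_chart p q : dom p q -> is_mdiff q (chart p) (to_chart p q).
Proof. by move=> pq; apply: is_diff_transition => //; exact: mem_dom. Qed.

Lemma is_mdiff_of_chart (W : normedModType R) p q (F : M -> W) dF : dom p q ->
  is_mdiff q F dF -> is_diff (chart p q) (F \o ichart p) (dF \o of_chart p q).
Proof.
move=> pq dFq; have dt := is_diff_transition pq (mem_dom q).
have dFq' : is_diff ((chart q \o ichart p) (chart p q)) (F \o ichart q) dF.
  by rewrite /= chartK.
apply: is_diff_near (is_diff_comp dt dFq').
have := near_ichart pq (near_dom (mem_dom q)).
by apply: filterS => x /= qx; rewrite chartK.
Qed.

Lemma of_chartK p q : dom p q -> cancel (of_chart p q) (to_chart p q).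
Proof.
move=> pq v; have d1 := is_mdiff_of_chart pq (is_mdiff_chart pq).
have d2 : is_diff (chart p q) (chart p \o ichart p) id.
  apply: is_diff_near (is_diff_id _).
  by apply: filterS (near_ichartK pq) => x /= ->.
by have /(congr1 (@^~ v)) := is_diff_unique d1 d2.
Qed.

Lemma is_mdiff_chart_id p : is_mdiff p (chart p) id.
Proof.
apply: is_diff_near (is_diff_id _).
by apply: filterS (near_ichartK (mem_dom p)) => x /= ->.
Qed.

Lemma to_chart_id p v : to_chart p p v = v.
Proof.
have /(congr1 (@^~ v)) := is_mdiff_unique (is_mdiff_chart (mem_dom p))
  (is_mdiff_chart_id p).
exact.
Qed.

Lemma of_chart_id p v : of_chart p p v = v.
Proof. exact: to_chart_id. Qed.

Lemma to_chartK p q : dom p q -> cancel (to_chart p q) (of_chart p q).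
Proof.
move=> pq v.
have d1 : is_diff (chart q q) (chart p \o ichart q) (to_chart p q).
  exact: is_mdiff_chart.
have d2 : is_diff ((chart p \o ichart q) (chart q q)) (chart q \o ichart p)
    (of_chart p q).
  rewrite /= chartK; last exact: mem_dom.
  by apply: is_diff_transition => //; exact: mem_dom.
have d3 : is_diff (chart q q) ((chart q \o ichart p) \o (chart p \o ichart q)) id.
  apply: is_diff_near (is_diff_id _).
  apply: filterS2 (near_ichartK (mem_dom q))
    (near_ichart (mem_dom q) (near_dom pq)) => x xE px /=.
  by rewrite chartK.
by have /(congr1 (@^~ v)) := is_diff_unique (is_diff_comp d1 d2) d3.
Qed.

(** The continuity built into [is_velocity] keeps [c s] in the domain of the chart at [c t] for [s]
    near [t]; there [F \o c] factors through the chart and the chain rule applies. *)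
Lemma is_mdiff_deriv (W : normedModType R) (I : set R) (c : R -> M) t v
    (F : M -> W) dF : I t ->
  is_mdiff (c t) F dF -> is_velocity I c t v ->
  is_deriv_within I (F \o c) t (dF v).
Proof.
move=> It dFc [cc dc].
have := is_deriv_within_comp dFc dc; apply: is_deriv_within_near => //.
have : \forall s \near t, I s -> dom (c t) (c s).
  exact: (cc _ (near_dom (mem_dom (c t)))).
by apply: filterS => s H Is /=; rewrite chartK//; exact: H.
Qed.

End OneManifold.

Section TwoManifolds.
Context {n m : nat} {M : manifoldType R n} {N : manifoldType R m}.

Lemma is_mdiff_comp (W : normedModType R) (phi : M -> N) p (F : N -> W) T dF :
  {for p, continuous phi} -> is_mdiff p (chart (phi p) \o phi) T ->
  is_mdiff (phi p) F dF -> is_mdiff p (F \o phi) (dF \o T).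
Proof.
move=> cphi dphi dFp.
have dFp' : is_diff ((chart (phi p) \o phi \o ichart p) (chart p p))
    (F \o ichart (phi p)) dF.
  by rewrite /= chartK//; exact: mem_dom.
apply: is_diff_near (is_diff_comp dphi dFp').
have := near_ichart (mem_dom p) (cphi _ (near_dom (mem_dom (phi p)))).
by apply: filterS => x /= px; rewrite chartK.
Qed.

Lemma is_velocity_comp (I : set R) (c : R -> M) t v (phi : M -> N) T : I t ->
  {for c t, continuous phi} -> is_mdiff (c t) (chart (phi (c t)) \o phi) T ->
  is_velocity I c t v -> is_velocity I (phi \o c) t (T v).
Proof.
move=> It cphi dphi vc; split; last exact: (is_mdiff_deriv It dphi vc).
by case: vc => cc _; exact: (cvg_comp _ _ cc cphi).
Qed.

Lemma smooth_near_differentiable (V W : normedModType R) (f : V -> W) x :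
  smooth_near f x -> \forall y \near x, differentiable f y.
Proof.
move=> [A [oA Ax fA]]; have := open_nbhs_nbhs (conj oA Ax).
by apply: filterS => y Ay; have [+ _] := fA 1; apply.
Qed.

Lemma smooth_near_diff (V W : normedModType R) (f : V -> W) x v :
  smooth_near f x -> smooth_near (fun y => 'd f y v) x.
Proof.
move=> [A [oA Ax fA]]; exists A; split=> // k.
by have [_] := fA k.+1; apply.
Qed.

Lemma smooth_near_is_diff (V W : normedModType R) (f : V -> W) x :
  smooth_near f x -> is_diff x f ('d f x).
Proof.
by move=> /smooth_near_differentiable/nbhs_singleton; exact: differentiableP.
Qed.

Lemma smooth_mapP (phi : M -> N) p : smooth_map phi ->
  {for p, continuous phi} /\ is_mdiff p (chart (phi p) \o phi) (Tmap phi p).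
Proof.
by move=> /(_ p)[cphi sphi]; split=> //; exact: smooth_near_is_diff.
Qed.

End TwoManifolds.

End ManifoldCalculus.

(** * Closure properties of C^k maps *)

Section CkComposition.
Context {R : realType} {U : normedModType R} (A : set U) (oA : open A).

Lemma Ck_pred (W : normedModType R) k (f : U -> W) : Ck k.+1 A f -> Ck k A f.
Proof.
elim: k f => [|k IH] f [df cdf].
  by move=> x Ax; exact: differentiable_continuous (df x Ax).
by split=> // v; exact: IH (cdf v).
Qed.

Lemma Ck_is_diff (W : normedModType R) k (f : U -> W) x : Ck k.+1 A f -> A x ->
  is_diff x f ('d f x).
Proof. by move=> [df _] Ax; exact/differentiableP/df. Qed.

Lemma CkSP (W : normedModType R) k (f : U -> W) (df : U -> U -> W) :
  (forall x, A x -> is_diff x f (df x)) -> (forall v, Ck k A (df ^~ v)) ->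
  Ck k.+1 A f.
Proof.
move=> dfx cdf; split=> [x Ax|v]; first by have [] := dfx x Ax.
by apply: (Ck_eq oA) (cdf v) => x Ax; have [_ ->] := dfx x Ax.
Qed.

Lemma Ck_cst (W : normedModType R) k (c : W) : Ck k A (fun=> c).
Proof.
elim: k c => [|k IH] c; first by move=> x _; exact: cst_continuous.
by apply: (@CkSP _ _ _ (fun _ _ => 0)) => v; exact: IH.
Qed.

Lemma CkD (W : normedModType R) k (f g : U -> W) :
  Ck k A f -> Ck k A g -> Ck k A (fun x => f x + g x).
Proof.
elim: k f g => [|k IH] f g cf cg.
  by move=> x Ax; apply: continuousD; [exact: cf|exact: cg].
apply: (@CkSP _ _ _ (fun x v => 'd f x v + 'd g x v)) => [x Ax|v].
  exact: (is_diffD (Ck_is_diff cf Ax) (Ck_is_diff cg Ax)).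
exact: IH (cf.2 v) (cg.2 v).
Qed.

Lemma Ck_sum (W : normedModType R) k n (f : 'I_n -> U -> W) :
  (forall i, Ck k A (f i)) -> Ck k A (fun x => \sum_i f i x).
Proof.
move=> cf; have H (r : seq 'I_n) : Ck k A (fun x => \sum_(i <- r) f i x).
  elim: r => [|i r IH].
    by under eq_fun do rewrite big_nil; exact: Ck_cst.
  by under eq_fun do rewrite big_cons; exact: CkD.
exact: H.
Qed.

Lemma Ck_scale (W : normedModType R) k (h : U -> R^o) (f : U -> W) :
  Ck k A h -> Ck k A f -> Ck k A (fun x => h x *: f x).
Proof.
elim: k h f => [|k IH] h f ch cf.
  move=> x Ax; apply: cvgZ; [exact: ch|exact: cf].
apply: (@CkSP _ _ _ (fun x v => h x *: 'd f x v + 'd h x v *: f x)) => [x Ax|v].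
  exact: (is_diff_scale (Ck_is_diff ch Ax) (Ck_is_diff cf Ax)).
apply: CkD; first exact: IH (Ck_pred ch) (cf.2 v).
exact: IH (ch.2 v) (Ck_pred cf).
Qed.

Lemma Ck_coord k n (f : U -> 'rV[R]_n) i :
  Ck k A f -> Ck k A (fun x => f x 0 i : R^o).
Proof.
elim: k f => [|k IH] f cf.
  move=> x Ax; have H := cvg_comp _ _ (cf x Ax) (@coord_continuous R 1 n 0 i (f x)).
  exact: H.
apply: (@CkSP _ _ _ (fun x v => 'd f x v 0 i : R^o)) => [x Ax|v].
  exact: (is_diff_coord i (Ck_is_diff cf Ax)).
exact: IH (cf.2 v).
Qed.

(** In coordinates of the intermediate space the derivative of [g \o f] is a sum of coordinates of
    ['d f x v] times partial derivatives of [g] composed with [f], to which the induction hypothesis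
    applies one order lower. *)
Lemma Ck_comp (W : normedModType R) k n (B : set 'rV[R]_n)
    (f : U -> 'rV[R]_n) (g : 'rV[R]_n -> W) :
  (forall x, A x -> B (f x)) -> Ck k A f -> Ck k B g -> Ck k A (g \o f).
Proof.
move=> AB; elim: k g => [|k IH] g cf cg.
  move=> x Ax; have H := cvg_comp _ _ (cf x Ax) (cg _ (AB x Ax)); exact: H.
have cgx x : A x -> is_diff (f x) g ('d g (f x)).
  by move=> Ax; apply/differentiableP/cg.1/AB.
apply: (@CkSP _ _ _ (fun x v =>
    \sum_i 'd f x v 0 i *: 'd g (f x) (delta_mx 0 i))) => [x Ax|v].
  have := is_diff_comp (Ck_is_diff cf Ax) (cgx x Ax).
  move/is_diff_eq; apply; apply/funext => v /=.
  rewrite [in LHS](rV_delta ('d f x v)) linear_sum.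
  by apply: eq_bigr => i _; rewrite linearZ.
apply: Ck_sum => i; apply: Ck_scale; first exact: Ck_coord (cf.2 v).
exact: (IH (fun y => 'd g y (delta_mx 0 i)) (Ck_pred cf) (cg.2 _)).
Qed.

End CkComposition.

Section SmoothNearComposition.
Context {R : realType}.

Lemma CkS (V W : normedModType R) k (A B : set V) (f : V -> W) :
  B `<=` A -> Ck k A f -> Ck k B f.
Proof.
move=> BA; elim: k f => [|k IH] f; first by move=> cf x /BA; exact: cf.
by move=> [df cdf]; split=> [x /BA|v]; [exact: df|by apply: IH; exact: cdf].
Qed.

Lemma smooth_near_comp (V W : normedModType R) n (f : V -> 'rV[R]_n)
    (g : 'rV[R]_n -> W) x :
  smooth_near f x -> smooth_near g (f x) -> smooth_near (g \o f) x.
Proof.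
move=> [A [oA Ax fA]] [B [oB Bx gB]]; exists (A `&` f @^-1` B).
have oAB : open (A `&` f @^-1` B).
  rewrite openE => y [Ay By]; apply: filterI; first by apply: open_nbhs_nbhs.
  by apply: (fA 0%N y Ay); exact: open_nbhs_nbhs.
split=> // k; apply: (@Ck_comp _ _ _ oAB _ _ _ B); last exact: gB.
  by move=> y [].
by apply: CkS (fA k) => y [].
Qed.

Lemma smooth_nearI (V W1 W2 : normedModType R) (f : V -> W1) (g : V -> W2) x :
  smooth_near f x -> smooth_near g x ->
  exists A, [/\ open A, A x, smooth_on A f & smooth_on A g].
Proof.
move=> [A [oA Ax fA]] [B [oB Bx gB]]; exists (A `&` B); split=> //.
- exact: openI.
- by move=> k; apply: CkS (fA k) => y [].
- by move=> k; apply: CkS (gB k) => y [].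
Qed.

Lemma smooth_near_apply (V W : normedModType R) n (b : V -> 'rV[R]_n -> W)
    (w : V -> 'rV[R]_n) x :
  (forall y, linear (b y)) -> (forall u, smooth_near (b ^~ u) x) ->
  smooth_near w x -> smooth_near (fun y => b y (w y)) x.
Proof.
move=> lin sb sw; have bE y : b y (w y) = \sum_i w y 0 i *: b y (delta_mx 0 i).
  pose bM := GRing.isLinear.Build _ _ _ _ _ (lin y).
  pose bL : {linear 'rV[R]_n -> W} := HB.pack (b y) bM.
  rewrite [in LHS](rV_delta (w y)) -[b y]/(bL : _ -> _) linear_sum.
  by apply: eq_bigr => i _; rewrite linearZ.
under eq_fun do rewrite bE.
have H (r : seq 'I_n) :
    smooth_near (fun y => \sum_(i <- r) w y 0 i *: b y (delta_mx 0 i)) x.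
  elim: r => [|i r IH].
    by under eq_fun do rewrite big_nil; exact: smooth_near_cst.
  under eq_fun do rewrite big_cons.
  have st : smooth_near (fun y => w y 0 i *: b y (delta_mx 0 i)) x.
    have [A [oA Ax wA bA]] := smooth_nearI sw (sb (delta_mx 0 i)).
    exists A; split=> // k; apply: Ck_scale => //; exact: Ck_coord.
  have [A [oA Ax tA rA]] := smooth_nearI st IH.
  by exists A; split=> // k; exact: CkD.
exact: H.
Qed.

(** On a small ball the differential differs from ['d f x] by at most 1 in operator norm, whence the
    constant [1 + k]. The ball is convex, so the mean value inequality applies on the segment
    between two of its points. *)
Lemma smooth_near_lipschitz m n (f : 'rV[R]_m -> 'rV[R]_n) x :
  smooth_near f x -> exists2 L, 0 <= L &
    \forall z \near (x, x), `|f z.1 - f z.2| <= L * `|z.1 - z.2|.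
Proof.
move=> sf; pose A y w := 'd f y w - 'd f x w.
have linA y : linear (A y).
  move=> k u v; rewrite /A.
  transitivity (k *: 'd f y u + 'd f y v - (k *: 'd f x u + 'd f x v)).
    by congr (_ - _); exact: linearP.
  by rewrite scalerBr opprD addrACA.
have A0 w e : 0 < e -> \forall y \near x, `|A y w| <= e.
  move=> e0; have [dw _] := smooth_near_is_diff (smooth_near_diff w sf).
  have /cvgrPdist_le/(_ e e0) := differentiable_continuous dw.
  apply: filterS => y Hy.
  have E : `|A y w| = `|'d f x w - 'd f y w| by exact: distrC.
  by rewrite E.
have [k k0 Hk] : exists2 k, 0 < k & forall w, `|'d f x w| <= k * `|w|.
  apply: linear_lipschitz; apply: linear_rV_continuous; exact: linearP.
have [d d0 Hd] : exists2 d, 0 < d & forall y, `|y - x| < d ->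
    differentiable f y /\ forall w, `|A y w| <= 1 * `|w|.
  apply/nbhs_distP; have H1 := smooth_near_differentiable sf.
  have H2 := near_linear_bound (@nbhs_filter _ x) linA A0 ltr01.
  by apply: filterS2 H1 H2 => y.
exists (1 + k); first by rewrite addr_ge0// ltW.
apply/nbhs_distP; exists d => // -[y y'] /=.
rewrite prod_normE /= gt_max => /andP[yd y'd].
rewrite -[in f y](subrK y' y) [y - y' + y']addrC.
apply: mean_value_le => [|t /andP[t0 t1]]; first by rewrite mulr_ge0// addr_ge0// ltW.
have : `|y' + t *: (y - y') - x| < d.
  have -> : y' + t *: (y - y') - x = (1 - t) *: (y' - x) + t *: (y - x).
    by apply/rowP => i; rewrite !mxE; ring.
  have H : (1 - t) * `|y' - x| + t * `|y - x| < d.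
    have [->|tn0] := eqVneq t 0; first by rewrite subr0 mul1r mul0r addr0.
    have tp : 0 < t by rewrite lt_neqAle eq_sym tn0.
    have -> : d = (1 - t) * d + t * d by ring.
    apply: ler_ltD; last by rewrite ltr_pM2l.
    by rewrite ler_wpM2l ?subr_ge0// ltW.
  apply: le_lt_trans H; rewrite (le_trans (ler_normD _ _))// !normrZ.
  by rewrite !ger0_norm// subr_ge0.
set u := y' + _; set v := y - y'.
move=> /Hd[df Aw]; split; first exact: df.
have -> : (1 + k) * `|v| = 1 * `|v| + k * `|v| by ring.
have -> : 'd f u v = A u v + 'd f x v by exact: (esym (subrK _ _)).
apply: le_trans (ler_normD _ _) _; apply: lerD; [exact: Aw|exact: Hk].
Qed.

Lemma smooth_family_lipschitz m n l (b : 'rV[R]_m -> 'rV[R]_n -> 'rV[R]_l) x :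
  (forall y, linear (b y)) -> (forall u, smooth_near (b ^~ u) x) ->
  exists2 L, 0 <= L & \forall z \near (x, x), forall w,
    `|b z.1 w - b z.2 w| <= L * `|z.1 - z.2| * `|w|.
Proof.
move=> lin sb.
have /choice[L LP] : forall i : 'I_n, exists L, 0 <= L /\ \forall z \near (x, x),
    `|b z.1 (delta_mx 0 i) - b z.2 (delta_mx 0 i)| <= L * `|z.1 - z.2|.
  by move=> i; have [L L0 HL] := smooth_near_lipschitz (sb (delta_mx 0 i)); exists L.
exists (\sum_i L i); first by apply: sumr_ge0 => i _; case: (LP i).
have /filter_forall : forall i, \forall z \near (x, x),
    `|b z.1 (delta_mx 0 i) - b z.2 (delta_mx 0 i)| <= L i * `|z.1 - z.2|.
  by move=> i; case: (LP i).
apply: filterS => z Hz w.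
have bE y : b y w = \sum_i w 0 i *: b y (delta_mx 0 i).
  pose bM := GRing.isLinear.Build _ _ _ _ _ (lin y).
  pose bL : {linear 'rV[R]_n -> 'rV[R]_l} := HB.pack (b y) bM.
  rewrite [in LHS](rV_delta w) -[b y]/(bL : _ -> _) linear_sum.
  by apply: eq_bigr => i _; rewrite linearZ.
rewrite !bE -sumrB (le_trans (ler_norm_sum _ _ _))// !mulr_suml.
apply: ler_sum => i _; rewrite -scalerBr normrZ mulrC.
by rewrite ler_pM// ler_coord_norm.
Qed.

End SmoothNearComposition.

(** * Left translations of a Lie group *)

Section LieGroupCalculus.
Context {R : realType} {n : nat} {G : lieGroupType R n}.
Implicit Types g h : G.

Lemma continuous_lmul g h : {for h, continuous (fun x : G => (g * x)%g)}.
Proof.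
have : (fun x : G => (g, x)) @ h --> (g, h) by apply: cvg_pair; [exact: cvg_cst|].
move=> H; have Hm := cvg_comp _ _ H (@continuous_mulg _ _ G (g, h)); exact: Hm.
Qed.

Lemma smooth_near_lmul g h :
  smooth_near (chart (g * h)%g \o (fun x : G => (g * x)%g) \o ichart h)
    (chart h h).
Proof.
pose S (y : 'rV[R]_n) := ((0 : 'rV[R]_n), y).
have lin : linear S.
  by move=> k u v; congr (_, _); rewrite /= scaler0 add0r.
have cS := linear_rV_continuous lin.
have := @smooth_near_affine _ _ _ _ _ S (chart g g, 0) (chart h h) lin cS.
rewrite [(chart g g, 0) + _](_ : _ = (chart g g, chart h h)); last first.
  by congr (_, _); rewrite ?addr0 ?add0r.
move=> /(_ _ _ (smooth_mulg g h)); apply: smooth_near_eq; near=> y => /=.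
by rewrite addr0 add0r chartK//; exact: mem_dom.
Unshelve. all: by end_near. Qed.

Lemma is_mdiff_lmul g h :
  is_mdiff h (chart (g * h)%g \o (fun x : G => (g * x)%g)) (Tleft g h).
Proof. exact: smooth_near_is_diff (smooth_near_lmul g h). Qed.

Lemma Tleft_comp g1 g2 h v :
  Tleft g1 (g2 * h)%g (Tleft g2 h v) = Tleft (g1 * g2)%g h v.
Proof.
have := is_mdiff_comp (@continuous_lmul g2 h) (is_mdiff_lmul g2 h)
  (is_mdiff_lmul g1 (g2 * h)%g).
have := is_mdiff_lmul (g1 * g2)%g h.
rewrite mulgA [X in is_mdiff h X](_ : _ = ((chart (g1 * g2 * h)%g
    \o (fun x : G => (g1 * x)%g)) \o (fun x : G => (g2 * x)%g))); last first.
  by apply/funext => x; rewrite /= mulgA.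
by move=> d1 d2; have /(congr1 (@^~ v)) := is_mdiff_unique d2 d1.
Qed.

Lemma Tleft1 h v : Tleft (1%g : G) h v = v.
Proof.
have := is_mdiff_lmul 1%g h; rewrite mul1g.
rewrite (_ : (chart h \o _) = chart h); last first.
  by apply/funext => x; rewrite /= mul1g.
by move=> d1; have /(congr1 (@^~ v)) := is_mdiff_unique d1 (is_mdiff_chart_id h).
Qed.

Lemma TleftK g v : Tleft g^-1%g g (Tleft g 1%g v) = v.
Proof. by rewrite -[X in Tleft _ X]mulg1 Tleft_comp mulVg Tleft1. Qed.

Lemma TleftVK g v : Tleft g 1%g (Tleft g^-1%g g v) = v.
Proof. by rewrite -[X in Tleft _ X](mulVg g) Tleft_comp mulgV Tleft1. Qed.

Definition chart_mul (x : 'rV[R]_n * 'rV[R]_n) : 'rV[R]_n :=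
  chart (1%g : G) (ichart (1%g : G) x.1 * ichart (1%g : G) x.2)%g.

(* The left-invariant field of [v], in the chart at [1]. *)
Definition left_frame (x v : 'rV[R]_n) : 'rV[R]_n :=
  'd chart_mul (x, chart (1%g : G) (1%g : G)) (0, v).

Notation e := (chart (1%g : G) (1%g : G)).

Lemma smooth_chart_mul : smooth_near chart_mul (e, e).
Proof. by have := smooth_mulg (1%g : G) (1%g : G); rewrite mulg1. Qed.

Lemma linear_left_frame x : linear (left_frame x).
Proof.
move=> k u v; rewrite /left_frame -linearP; congr ('d _ _ (_, _)).
by rewrite /= scaler0 add0r.
Qed.

Lemma smooth_left_frame v : smooth_near (left_frame ^~ v) e.
Proof.
pose S (x : 'rV[R]_n) := (x, (0 : 'rV[R]_n)).
have lin : linear S by move=> k u w; congr (_, _); rewrite /= scaler0 add0r.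
have cS := linear_rV_continuous lin.
have := @smooth_near_affine _ _ _ _ (fun x => 'd chart_mul x (0, v)) S (0, e) e lin cS.
rewrite [(0, e) + _](_ : _ = (e, e)); last first.
  by congr (_, _); rewrite ?addr0 ?add0r.
move=> /(_ (smooth_near_diff (0, v) smooth_chart_mul)).
apply: smooth_near_eq; near=> y; rewrite /left_frame.
by rewrite [(0, e) + _](_ : _ = (y, e))//; congr (_, _); rewrite ?addr0 ?add0r.
Unshelve. all: by end_near. Qed.

Lemma is_diff_chart_mul : \forall x \near e,
  is_diff e (fun y => chart_mul (x, y)) (left_frame x).
Proof.
have /nbhs_distP[d d0 dm] := smooth_near_differentiable smooth_chart_mul.
apply/nbhs_distP; exists d => // x xd.
have dS : is_diff e (fun y : 'rV[R]_n => (x, y)) (fun v => (0, v)).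
  exact: is_diff_pair.
have dm' : is_diff (x, e) chart_mul ('d chart_mul (x, e)).
  apply/differentiableP/dm; rewrite prod_normE /= subrr normr0.
  by rewrite gt_max xd d0.
exact: (is_diff_comp dS dm').
Qed.

(** Both sides are the derivative at the coordinates of [1] of [y |-> F (k * ichart 1 y)] with
    [k = ichart 1 x], computed once on the group and once in coordinates through [chart_mul]. Since
    [F] is quantified inside, the neighbourhood does not depend on it. *)
Lemma near_left_frame : \forall x \near e,
  forall (W : normedModType R) (F : G -> W) (dF : 'rV[R]_n -> W),
    is_mdiff (ichart (1%g : G) x) F dF ->
    forall v, dF (Tleft (ichart (1%g : G) x) 1%g v) =
              'd (F \o ichart (1%g : G)) x (left_frame x v).
Proof.
apply: filterS3 is_diff_chart_mul (near_ichartK (mem_dom (1%g : G)))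
  (near_ichart (mem_dom (1%g : G)) (near_dom (mem_dom (1%g : G)))).
move=> x dm xK; set k := ichart _ x => k1 W F dF dFk v.
have d1 : is_mdiff 1%g (F \o (fun y => (k * y)%g)) (dF \o Tleft k 1%g).
  apply: is_mdiff_comp; [exact: continuous_lmul|exact: is_mdiff_lmul|].
  by rewrite mulg1.
have d2 : is_diff e (F \o ichart (1%g : G) \o (fun y => chart_mul (x, y)))
    ('d (F \o ichart (1%g : G)) x \o left_frame x).
  have xE : chart_mul (x, e) = x.
    by rewrite /chart_mul /= chartK ?mulg1//; exact: mem_dom.
  have dF' : is_diff (chart_mul (x, e)) (F \o ichart (1%g : G))
      ('d (F \o ichart (1%g : G)) x).
    rewrite xE; apply: differentiableP; have := is_mdiff_of_chart k1 dFk.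
    by rewrite xK => -[].
  exact: (is_diff_comp dm dF').
have d3 : is_diff e (F \o ichart (1%g : G) \o (fun y => chart_mul (x, y)))
    (dF \o Tleft k 1%g).
  apply: is_diff_near d1.
  have k1' : dom (1%g : G) (k * 1)%g by rewrite mulg1.
  have := near_ichart (mem_dom 1%g) (continuous_lmul (near_dom k1')).
  by apply: filterS => y kd /=; rewrite /chart_mul /= chartK.
by have /(congr1 (@^~ v)) := is_diff_unique d3 d2.
Qed.

Lemma left_frame_id v : left_frame e v = v.
Proof.
have d1 := nbhs_singleton is_diff_chart_mul.
suff d2 : is_diff e (fun y => chart_mul (e, y)) id.
  by have /(congr1 (@^~ v)) := is_diff_unique d1 d2.
apply: is_diff_near (is_diff_id _).
have := near_ichartK (mem_dom (1%g : G)); apply: filterS => y yK.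
by rewrite /chart_mul /= chartK ?mul1g//; exact: mem_dom.
Qed.

Lemma near_left_inv_field : \forall x \near e, forall v,
  to_chart (1%g : G) (ichart (1%g : G) x)
    (left_inv_field v (ichart (1%g : G) x)) = left_frame x v.
Proof.
apply: filterS3 near_left_frame (near_ichartK (mem_dom (1%g : G)))
  (near_ichart (mem_dom (1%g : G)) (near_dom (mem_dom (1%g : G)))).
move=> x H xK k1 v; rewrite /left_inv_field (H _ _ _ (is_mdiff_chart k1)).
suff [_ -> //] : is_diff x (chart (1%g : G) \o ichart (1%g : G)) id.
rewrite -[X in is_diff X]xK; apply: is_diff_near (is_diff_id _).
by apply: filterS (near_ichartK k1) => y /= ->.
Qed.

End LieGroupCalculus.

(** * Levi-Civita connections in charts and in left-invariant frames *)

Section SecondDerivatives.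
Context {R : realType}.

Definition twice_diff (V W : normedModType R) (f : V -> W) (x : V) : Prop :=
  (\forall y \near x, differentiable f y) /\
  forall v, differentiable (fun y => 'd f y v) x.

Lemma smooth_near_twice_diff (V W : normedModType R) (f : V -> W) x :
  smooth_near f x -> twice_diff f x.
Proof.
move=> sf; split=> [|v]; first exact: smooth_near_differentiable.
by have [] := smooth_near_is_diff (smooth_near_diff v sf).
Qed.

Lemma is_diff_comp_joint (U V W : normedModType R) n (b : V -> 'rV[R]_n -> W)
    (b' : 'rV[R]_n -> V -> W) (f df : U -> V) (w dw : U -> 'rV[R]_n) x :
  (forall y, linear (b y)) -> (forall u, is_diff (f x) (b ^~ u) (b' u)) ->
  is_diff x f df -> is_diff x w dw ->
  is_diff x (fun y => b (f y) (w y))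
    (fun v => b' (w x) (df v) + b (f x) (dw v)).
Proof.
move=> lin db dfx dwx.
exact: (is_diff_comp (is_diff_pair dfx dwx) (is_diff_joint (w x) lin db)).
Qed.

Lemma twice_diff_sym (V : normedModType R) n (f : V -> 'rV[R]_n) x v w :
  twice_diff f x ->
  'd (fun y => 'd f y v) x w = 'd (fun y => 'd f y w) x v.
Proof.
move=> [df ddf]; apply/rowP => i.
have dfi : \forall y \near x,
    is_diff y (fun z => f z 0 i : R^o) (fun u => 'd f y u 0 i).
  by apply: filterS df => y /differentiableP; exact: is_diff_coord.
have ddfi u : is_diff x (fun y => 'd (fun z => f z 0 i : R^o) y u : R^o)
    (fun h => 'd (fun y => 'd f y u) x h 0 i).
  apply: is_diff_near (is_diff_coord i (differentiableP (ddf u))).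
  by apply: filterS dfi => y [_ ->].
apply: (diff_diff_sym _ (ddfi v) (ddfi w)).
by apply: filterS dfi => y [].
Qed.

(** * Coordinate computation with a frame pushed forward by a map *)

Section MovingFrame.
Context {n k : nat} (e : 'rV[R]_n).
Context (lf Bm : 'rV[R]_n -> 'rV[R]_n -> 'rV[R]_n) (p : 'rV[R]_n -> 'rV[R]_k).
Context (lin : forall x, linear (lf x)) (lf1 : forall v, lf e v = v)
  (dlf : forall v, is_diff e (lf ^~ v) (Bm v)) (tp : twice_diff p e).

(** [A x v] is the frame field of [v] pushed forward by [p]. [B v] is its derivative at [e]: a
    second derivative of [p] plus the image of the derivative of the frame. *)
Let A x v := 'd p x (lf x v).
Let B v u := 'd (fun x => 'd p x v) e u + 'd p e (Bm v u).

Let linA x : linear (A x).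
Proof. by move=> c u v; rewrite /A lin linearP. Qed.

Let AE v : A e v = 'd p e v. Proof. by rewrite /A lf1. Qed.

Lemma is_diff_frame v : is_diff e (A ^~ v) (B v).
Proof.
have := @is_diff_comp_joint _ _ _ _ (fun y => 'd p y)
  (fun u => 'd (fun z => 'd p z u) e) id id (lf ^~ v) (Bm v) e.
rewrite lf1; apply=> //; first by move=> y; exact: linearP.
by move=> u; apply: differentiableP; have [_] := tp; apply.
Qed.

Lemma is_deriv_frame (I : set R) (x xi : R -> 'rV[R]_n) t v dxi : x t = e ->
  is_deriv_within I x t v -> is_deriv_within I xi t dxi ->
  is_deriv_within I (fun s => A (x s) (xi s)) t (B (xi t) v + 'd p e dxi).
Proof.
move=> xt dx dxi'.
have dj : is_diff (x t, xi t) (fun z => A z.1 z.2)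
    (fun z => B (xi t) z.1 + A e z.2).
  by rewrite xt; exact: (is_diff_joint _ linA is_diff_frame).
have := is_deriv_within_comp dj (is_deriv_within_pair dx dxi').
by rewrite /= AE.
Qed.

Context (h : 'rV[R]_k -> 'rV[R]_k -> 'rV[R]_k -> R^o)
  (dh : 'rV[R]_k -> 'rV[R]_k -> 'rV[R]_k -> R^o).
Context (hlin : forall y w, linear (fun u => h y u w))
  (hsym : forall y u w, h y u w = h y w u)
  (dhP : forall u w, is_diff (p e) (fun y => h y u w) (dh u w))
  (iso : forall u v, \forall x \near e,
    h (p x) (A x u) (A x v) = h (p e) ('d p e u) ('d p e v)).

(** By [iso] the function [x |-> h (p x) (A x u) (A x v)] is constant near [e]; this is the product
    rule for its three dependences on [x], in the direction [w]. *)
Lemma is_diff_metric u v w :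
  dh ('d p e u) ('d p e v) ('d p e w) + h (p e) (B u w) ('d p e v) +
  h (p e) ('d p e u) (B v w) = 0.
Proof.
have d1 a c : is_diff (p e, a) (fun z : 'rV[R]_k * 'rV[R]_k => h z.1 z.2 c)
    (fun z => dh a c z.1 + h (p e) z.2 c).
  exact: (@is_diff_joint _ _ _ _ (fun y a => h y a c) (fun a => dh a c)).
have dp : is_diff e p ('d p e).
  by apply: differentiableP; exact: (nbhs_singleton tp.1).
have d0 : is_diff e (fun x => (p x, A x u)) (fun z => ('d p e z, B u z)).
  exact: is_diff_pair dp (is_diff_frame u).
have linh (z : 'rV[R]_k * 'rV[R]_k) : linear (h z.1 z.2).
  by move=> c a b; rewrite ![h z.1 z.2 _]hsym; exact: hlin.
have d1' c : is_diff (p e, A e u) (fun z : 'rV[R]_k * 'rV[R]_k => h z.1 z.2 c)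
    (fun z => dh (A e u) c z.1 + h (p e) z.2 c) by exact: d1.
have d2 := is_diff_comp_joint linh d1' d0 (is_diff_frame v).
have d3 : is_diff e (fun x => h (p x) (A x u) (A x v)) 0.
  have ns : {near e, cst (h (p e) ('d p e u) ('d p e v)) =1
      (fun x => h (p x) (A x u) (A x v))}.
    by apply: filterS (iso u v) => x ->.
  exact: is_diff_near ns (is_diff_cst _ _).
have /(congr1 (@^~ w)) := is_diff_unique d2 d3.
by rewrite /= !AE.
Qed.

(** The identity [is_diff_metric] at [(xi, eta, xi)] minus half of the one at [(xi, xi, eta)] leaves
    [B xi eta - B eta xi] paired with the image of [xi]. The second derivatives of [p] cancel in
    that difference by symmetry, and the derivatives of the frame remain, that is, the bracket of
    the frame fields. *)
Lemma moving_frame_christoffel xi eta :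
  h (p e) (B xi xi) ('d p e eta) + dh ('d p e xi) ('d p e eta) ('d p e xi)
    - 2^-1 * dh ('d p e xi) ('d p e xi) ('d p e eta) =
  h (p e) ('d p e xi) ('d p e (Bm xi eta - Bm eta xi)).
Proof.
have H1 := is_diff_metric xi eta xi; have H2 := is_diff_metric xi xi eta.
rewrite [h _ (B xi eta) _]hsym in H2.
have -> : 'd p e (Bm xi eta - Bm eta xi) = B xi eta - B eta xi.
  have -> : 'd p e (Bm xi eta - Bm eta xi) =
      'd p e (Bm xi eta) - 'd p e (Bm eta xi) by exact: linearB.
  have aux (a b c d : 'rV[R]_k) : a = d -> b - c = a + b - (d + c).
    by move=> ->; rewrite opprD addrACA subrr add0r.
  exact: (aux _ _ _ _ (twice_diff_sym xi eta tp)).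
have -> : h (p e) ('d p e xi) (B xi eta - B eta xi) =
    h (p e) ('d p e xi) (B xi eta) - h (p e) ('d p e xi) (B eta xi).
  rewrite ![h _ ('d p e xi) _]hsym -scaleN1r addrC hlin.
  by rewrite scaleN1r addrC.
lra.
Qed.

End MovingFrame.

End SecondDerivatives.

(** * Koszul formulas for coordinate fields and for left-invariant fields *)

Section Connections.
Context {R : realType} {n : nat}.

Section ConstantFields.
Context {M : manifoldType R n} (p : M).

(** The field with constant coefficients in the chart at [p], which is the extension that
    [is_covariant_deriv] feeds to the connection. *)
Definition chart_field (v : 'rV[R]_n) (q : M) : 'rV[R]_n := of_chart p q v.

Let near_dom_p : \forall x \near chart p p, dom p (ichart p x).
Proof. exact: near_ichart (mem_dom p) (near_dom (mem_dom p)). Qed.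

Lemma smooth_chart_field v : smooth_field_near (chart_field v) p.
Proof.
apply: smooth_near_eq (smooth_near_cst v _).
by apply: filterS near_dom_p => x px /=; rewrite of_chartK.
Qed.

Lemma lie_bracket_chart_field u v :
  lie_bracket (chart_field u) (chart_field v) p = 0.
Proof.
have d0 w v' : 'd (fun x => to_chart p (ichart p x) (chart_field w (ichart p x)))
    (chart p p) v' = 0.
  suff [_ -> //] : is_diff (chart p p)
    (fun x => to_chart p (ichart p x) (chart_field w (ichart p x))) 0.
  apply: is_diff_near (is_diff_cst w _).
  by apply: filterS near_dom_p => x px; rewrite of_chartK.
by transitivity (0 - 0 : 'rV[R]_n); [congr (_ - _); exact: d0|exact: subr0].
Qed.

Context {met : M -> 'rV[R]_n -> 'rV[R]_n -> R}
  {nabla : M -> 'rV[R]_n -> (M -> 'rV[R]_n) -> 'rV[R]_n}.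
Context (hmet : riemannian_metric met) (hnabla : levi_civita met nabla).

(* Christoffel symbols of the first kind *)
Lemma levi_civita_chart_field u w :
  met p (nabla p u (chart_field u)) w =
  dfun (fun q => met q (chart_field u q) (chart_field w q)) p u -
  2^-1 * dfun (fun q => met q (chart_field u q) (chart_field u q)) p w.
Proof.
have [_ torsion compat] := hnabla; have [mlin msym _ _] := hmet.
have C v : chart_field v p = v by exact: of_chart_id.
have sC := smooth_chart_field.
(* Metric compatibility along [u] for the pair [(u, w)] and along [w] for [(u, u)]. Coordinate
   fields commute, so vanishing torsion exchanges [nabla_u w] and [nabla_w u], and half of the
   second identity removes this term from the first. *)
have H1 := compat p u _ _ (sC u) (sC w).
have H2 := compat p w _ _ (sC u) (sC u).
have H3 := torsion p _ _ (sC u) (sC w).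
rewrite !C in H1 H2 H3.
move: H3; rewrite lie_bracket_chart_field => /eqP; rewrite subr_eq0 => /eqP H3.
rewrite H3 in H1; rewrite [met p _ u]msym in H2.
rewrite H1 H2; lra.
Qed.

End ConstantFields.

Section LeftInvariant.
Context {G : lieGroupType R n}.
Notation e := (chart (1%g : G) (1%g : G)).

Lemma smooth_left_inv_field v : smooth_field_near (left_inv_field v) (1%g : G).
Proof.
apply: smooth_near_eq (smooth_left_frame v).
by apply: filterS near_left_inv_field => x /= ->.
Qed.

Lemma left_inv_field1 (v : 'rV[R]_n) : left_inv_field v (1%g : G) = v.
Proof. exact: Tleft1. Qed.

Lemma lie_bracket_left_inv u v :
  lie_bracket (left_inv_field u) (left_inv_field v) (1%g : G) =
  'd (fun x => left_frame (G := G) x v) e u -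
  'd (fun x => left_frame (G := G) x u) e v.
Proof.
have d0 w v' : 'd (fun x => to_chart (1%g : G) (ichart (1%g : G) x)
    (left_inv_field w (ichart (1%g : G) x))) e (left_inv_field v' (1%g : G)) =
    'd (fun x => left_frame (G := G) x w) e v'.
  rewrite left_inv_field1.
  have [_ H] : is_diff e (fun x => to_chart (1%g : G)
    (ichart (1%g : G) x) (left_inv_field w (ichart (1%g : G) x)))
    ('d (fun x => left_frame (G := G) x w) e).
    apply: is_diff_near (smooth_near_is_diff (smooth_left_frame (G := G) w)).
    by apply: filterS near_left_inv_field => x ->.
  exact: (congr1 (@^~ v') H).
by congr (_ - _); exact: d0.
Qed.

Context {met : G -> 'rV[R]_n -> 'rV[R]_n -> R}
  {nabla : G -> 'rV[R]_n -> (G -> 'rV[R]_n) -> 'rV[R]_n}.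
Context (hmet : riemannian_metric met) (hnabla : levi_civita met nabla)
  (hinv : left_invariant_metric met).

(** Inner products of left-invariant fields are constant, so compatibility gives [<nabla_xi xi, eta>
    = - <xi, nabla_xi eta>] and [<xi, nabla_eta xi> = 0]. Torsion turns the sum into [<xi,
    [eta, xi]>], in the same form as the right-hand side of [moving_frame_christoffel]. *)
Lemma nabla_g_adjoint xi eta :
  met 1%g (nabla_g nabla xi xi) eta =
  met 1%g xi ('d (fun x => left_frame (G := G) x xi) e eta -
              'd (fun x => left_frame (G := G) x eta) e xi).
Proof.
have [_ torsion compat] := hnabla; have [mlin msym _ _] := hmet.
have sL := smooth_left_inv_field.
have d0 u v w : dfun (fun q => met q (left_inv_field u q) (left_inv_field v q)) 1%g w = 0.
  rewrite (_ : (fun q => _) = cst (met 1%g u v)); last first.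
    by apply/funext => q; have := hinv q 1%g u v; rewrite mulg1.
  by rewrite /dfun (_ : _ \o _ = cst (met 1%g u v))// diff_cst.
have H1 := compat 1%g xi _ _ (sL xi) (sL eta).
have H2 := compat 1%g eta _ _ (sL xi) (sL xi).
have H3 := torsion 1%g _ _ (sL xi) (sL eta).
rewrite !d0 !left_inv_field1 in H1 H2 H3.
rewrite /nabla_g left_inv_field1.
have mB u v w : met 1%g w (u - v) = met 1%g w u - met 1%g w v.
  rewrite ![met 1%g w _]msym; have := mlin 1%g (-1) v u w.
  by rewrite scaleN1r [- v + u]addrC mulN1r [- _ + _]addrC.
transitivity (met 1%g xi (nabla 1%g eta (left_inv_field xi) -
                          nabla 1%g xi (left_inv_field eta))); last first.
  congr (met _ _ _); rewrite -opprB H3 lie_bracket_left_inv.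
  exact: opprB.
rewrite mB; rewrite [met _ (nabla _ eta _) _]msym in H2; lra.
Qed.

End LeftInvariant.
End Connections.

(** * Riemannian homogeneous spaces *)

Section Metrics.
Context {R : realType} {n : nat} {M : manifoldType R n}
  {met : M -> 'rV[R]_n -> 'rV[R]_n -> R} (hmet : riemannian_metric met).

Lemma metP p k u v w : met p (k *: u + v) w = k * met p u w + met p v w.
Proof. by have [+ _ _ _] := hmet; apply. Qed.

Lemma metC p v w : met p v w = met p w v.
Proof. by have [_ + _ _] := hmet; apply. Qed.

Lemma met0l p w : met p 0 w = 0.
Proof. by have := metP p (-1) 0 0 w; rewrite scaler0 addr0; lra. Qed.

Lemma metDl p u v w : met p (u + v) w = met p u w + met p v w.
Proof. by rewrite -[u]scale1r metP mul1r scale1r. Qed.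

Lemma metZl p k u w : met p (k *: u) w = k * met p u w.
Proof. by rewrite -[k *: u]addr0 metP met0l addr0. Qed.

Lemma metNl p u w : met p (- u) w = - met p u w.
Proof. by rewrite -scaleN1r metZl mulN1r. Qed.

Lemma met_suml p I r (P : pred I) (F : I -> 'rV[R]_n) w :
  met p (\sum_(i <- r | P i) F i) w = \sum_(i <- r | P i) met p (F i) w.
Proof. by elim/big_rec2: _ => [|i a b _ <-]; rewrite ?met0l// metDl. Qed.

Lemma met_inj p u v : (forall w, met p u w = met p v w) -> u = v.
Proof.
move=> uv; apply/eqP; rewrite -subr_eq0; apply/negPn/negP => uv0.
have [_ _ /(_ p _ uv0) + _] := hmet.
by rewrite metDl metNl uv subrr ltxx.
Qed.

(** [grad] is a choice with default [0]; Riesz representation shows that the default is never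
    taken. *)
Lemma gradP (f : M -> R^o) p v : met p (grad met f p) v = dfun f p v.
Proof.
have [w wP] := @riesz_rV R n (met p) ('d (f \o ichart p) (chart p p))
  (metP p) (metC p) (fun v => let: And4 _ _ H _ := hmet in H p v).
have /(xgetPex 0) H : [set w | forall v, met p w v = dfun f p v] !=set0.
  by exists w; exact: wP.
exact: H.
Qed.

End Metrics.

(** The subspace [d] is the kernel of [v |-> v - projv d v]. This linear map vanishes along [xi],
    hence also on the derivative of [xi], by uniqueness of derivatives. *)
Lemma deriv_within_mem (R : realType) n (d : {vspace 'rV[R]_n}) (a b : R)
    (xi : R -> 'rV[R]_n) t dxi : a < b -> t \in `[a, b] ->
  (forall s, s \in `[a, b] -> xi s \in d) ->
  is_deriv_within `[a, b] xi t dxi -> dxi \in d.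
Proof.
move=> ab tab xid dx; pose L (v : 'rV[R]_n) := v - projv d v.
have linL : linear L.
  by move=> k u v; rewrite /L linearP scalerBr opprD addrACA.
have dL := is_diff_linear (xi t) linL (linear_rV_continuous linL).
have L0 s : s \in `[a, b] -> L (xi s) = 0.
  by move=> /xid xs; rewrite /L projv_id// subrr.
have d1 := is_deriv_within_comp dL dx.
have d2 : is_deriv_within `[a, b] (L \o xi) t 0.
  apply/is_deriv_withinP => e e0; near=> s => sI /=.
  by rewrite !L0// scaler0 !subr0 normr0 mulr_ge0// ltW.
have /eqP := is_deriv_within_unique ab tab d1 d2.
by rewrite subr_eq0 => /eqP ->; exact: memv_proj.
Unshelve. all: by end_near. Qed.

(* [Tmap] and [Tleft] stripped of their [{linear _ -> _}] structure, whose
   unification across different dimensions is intractable. *)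
Definition dmap {R : realType} {n m : nat} {M : manifoldType R n}
  {N : manifoldType R m} (f : M -> N) (p : M) (v : 'rV[R]_n) : 'rV[R]_m :=
  Tmap f p v.

Definition dleft {R : realType} {n : nat} {G : lieGroupType R n} (g h : G)
  (v : 'rV[R]_n) : 'rV[R]_n := Tleft g h v.

Section HomogeneousSpace.
Context {R : realType} {nG nH : nat} {G : lieGroupType R nG}
  {H : manifoldType R nH} {K : set G} {prj : G -> H} {Phi : G -> H -> H}
  {metG : G -> 'rV[R]_nG -> 'rV[R]_nG -> R}
  {metH : H -> 'rV[R]_nH -> 'rV[R]_nH -> R}.
Context (hH : homogeneous_space K prj Phi) (hmetG : riemannian_metric metG)
  (hmetG_inv : left_invariant_metric metG)
  (hmetH : riemannian_metric metH) (hpi : riemannian_submersion metG metH prj).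
Implicit Types g h : G.

Lemma smooth_projection : smooth_map prj. Proof. by case: hH. Qed.

Lemma Tmap_surj g w : exists v, Tmap prj g v = w.
Proof. by case: hH => _ _ _ + _; apply. Qed.

Lemma action_projection g h : Phi g (prj h) = prj (g * h)%g.
Proof. by case: hH => _ _ _ _; apply. Qed.

Lemma continuous_projection g : {for g, continuous prj}.
Proof. by have [] := smooth_mapP g smooth_projection. Qed.

Lemma is_mdiff_projection g : is_mdiff g (chart (prj g) \o prj) (Tmap prj g).
Proof. by have [] := smooth_mapP g smooth_projection. Qed.

Lemma is_mdiff_projection_lmul g h :
  is_mdiff h (chart (prj (g * h)%g) \o (fun x => prj (g * x)%g))
    (Tmap prj (g * h)%g \o Tleft g h).
Proof.
exact: (is_mdiff_comp (@continuous_lmul _ _ _ g h) (is_mdiff_lmul g h)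
  (is_mdiff_projection (g * h)%g)).
Qed.

(** [Tmap (Phi g)] is meaningful only once [Phi g] is known to be differentiable. This follows from
    [Phi g \o prj] being the smooth map [h |-> prj (g * h)]; the points [prj h] exhaust [H]. *)
Lemma is_mdiff_action g h :
  is_mdiff (prj h) (chart (prj (g * h)%g) \o Phi g) (Tmap (Phi g) (prj h)).
Proof.
rewrite /is_mdiff /Tmap action_projection; apply: differentiableP.
have [_ spi] := smooth_projection h.
pose f := chart (prj h) \o prj \o ichart h.
have fE : f (chart h h) = chart (prj h) (prj h).
  by rewrite /f /= chartK//; exact: mem_dom.
rewrite -fE; apply: differentiable_factor.
- exact: smooth_near_differentiable.
- move=> v; apply: differentiable_continuous.
  by have [] := smooth_near_is_diff (smooth_near_diff v spi).
- exact: Tmap_surj.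
have [] // : is_diff (chart h h)
    ((chart (prj (g * h)%g) \o Phi g \o ichart (prj h)) \o f)
    (Tmap prj (g * h)%g \o Tleft g h).
apply: is_diff_near (is_mdiff_projection_lmul g h).
have := near_ichart (mem_dom h)
  (continuous_projection (near_dom (mem_dom (prj h)))).
by apply: filterS => x hx; rewrite /f /= chartK// action_projection.
Qed.

Lemma dmap_action g h v :
  dmap (Phi g) (prj h) (dmap prj h v) = dmap prj (g * h)%g (dleft g h v).
Proof.
have d2 := is_mdiff_comp (@continuous_projection h) (is_mdiff_projection h)
  (is_mdiff_action g h).
have d3 := is_mdiff_projection_lmul g h.
have E : chart (prj (g * h)%g) \o (fun x => prj (g * x)%g) =
    (chart (prj (g * h)%g) \o Phi g) \o prj.
  by apply/funext => x; rewrite /= action_projection.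
rewrite E in d3.
exact: (congr1 (@^~ v) (is_mdiff_unique d2 d3)).
Qed.

Lemma dmap0 n m (M : manifoldType R n) (N : manifoldType R m) (f : M -> N) p :
  dmap f p 0 = 0.
Proof. exact: linear0. Qed.

Lemma dmapB n m (M : manifoldType R n) (N : manifoldType R m) (f : M -> N) p u v :
  dmap f p (u - v) = dmap f p u - dmap f p v.
Proof. exact: linearB. Qed.

Lemma dleft_comp g1 g2 h v :
  dleft g1 (g2 * h)%g (dleft g2 h v) = dleft (g1 * g2)%g h v.
Proof. exact: Tleft_comp. Qed.

Lemma dleft1 h v : dleft (1%g : G) h v = v. Proof. exact: Tleft1. Qed.

Lemma dleftK g v : dleft g^-1%g g (dleft g 1%g v) = v.
Proof. exact: TleftK. Qed.

Lemma dleftVK g v : dleft g 1%g (dleft g^-1%g g v) = v.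
Proof. exact: TleftVK. Qed.

Lemma met_dleft g h v w :
  metG (g * h)%g (dleft g h v) (dleft g h w) = metG h v w.
Proof. exact: hmetG_inv. Qed.

Lemma HorP g v :
  Hor metG prj g v <-> forall w, dmap prj g w = 0 -> metG g v w = 0.
Proof. by []. Qed.

Lemma submersion_isometry g v w : Hor metG prj g v -> Hor metG prj g w ->
  metH (prj g) (dmap prj g v) (dmap prj g w) = metG g v w.
Proof. exact: (hpi g).1. Qed.

Lemma submersion_lift g u : exists2 v, Hor metG prj g v & dmap prj g v = u.
Proof. exact: (hpi g).2. Qed.

Local Opaque dmap dleft.

Lemma dleftVKr g h v : dleft g h (dleft g^-1%g (g * h)%g v) = v.
Proof. by rewrite -[X in dleft g X](mulKg g h) dleft_comp mulgV dleft1. Qed.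

(** Equivariance of [prj] sends a vertical vector at [g * h] back to a vertical vector at [h], and
    the metric is left-invariant. *)
Lemma Hor_lmul g h v : Hor metG prj h v -> Hor metG prj (g * h)%g (dleft g h v).
Proof.
move=> /HorP hv; apply/HorP => w w0; rewrite -(dleftVKr g h w) met_dleft.
apply: hv; have := dmap_action g^-1%g (g * h)%g w.
by rewrite w0 dmap0 mulKg.
Qed.

Lemma Hor_left g v : Hor metG prj 1%g v -> Hor metG prj g (dleft g 1%g v).
Proof. by move=> /(@Hor_lmul g _ _); rewrite mulg1. Qed.

Lemma Hor_leftV g v : Hor metG prj g v -> Hor metG prj 1%g (dleft g^-1%g g v).
Proof. by move=> /(@Hor_lmul g^-1%g _ _); rewrite mulVg. Qed.

(** One horizontal argument is enough: [w] differs from the horizontal lift of its image by a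
    vertical vector, which is orthogonal to [v]. *)
Lemma met_projection g v w : Hor metG prj g v ->
  metH (prj g) (dmap prj g v) (dmap prj g w) = metG g v w.
Proof.
move=> hv; have [w' hw' ww'] := submersion_lift g (dmap prj g w).
rewrite -ww' submersion_isometry//; apply/eqP; rewrite -subr_eq0; apply/eqP.
rewrite (metC hmetG) [metG g v w](metC hmetG) -(metNl hmetG) -(metDl hmetG).
by rewrite (metC hmetG); move/HorP : hv; apply; rewrite dmapB ww' subrr.
Qed.

Lemma metH_invariant g h v w :
  metH (prj (g * h)%g) (dmap prj (g * h)%g (dleft g h v))
    (dmap prj (g * h)%g (dleft g h w)) =
  metH (prj h) (dmap prj h v) (dmap prj h w).
Proof.
have [v' hv' vv'] := submersion_lift h (dmap prj h v).
rewrite -(dmap_action g h v) -vv' dmap_action met_projection; last first.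
  exact: Hor_lmul.
by rewrite met_dleft met_projection.
Qed.

Lemma Hor_dmap_inj g v : Hor metG prj g v -> dmap prj g v = 0 -> v = 0.
Proof.
move=> hv v0; apply: (met_inj hmetG (p := g)) => w.
by rewrite -met_projection// v0 (met0l hmetH) (met0l hmetG).
Qed.

(** * Projection, frame and metric in the charts at [1] and at the base point of [H] *)

Section BasePoint.
Context (g0 : G).
Notation e := (chart (1%g : G) (1%g : G)).
Notation q0 := (prj g0).

(** For a curve through [g0], the translate by [g0^-1] passes through [1]; this map takes its
    coordinates to those of the projected curve. *)
Definition chart_projection (x : 'rV[R]_nG) : 'rV[R]_nH :=
  chart q0 (prj (g0 * ichart (1%g : G) x)%g).

Lemma smooth_chart_projection : smooth_near chart_projection e.
Proof.
have [_ spi] := smooth_projection g0.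
have t := smooth_near_comp (smooth_near_lmul g0 (1%g : G))
  (g := chart (prj g0) \o prj \o ichart g0).
apply: smooth_near_eq (t _).
  have := continuous_lmul (g := g0) (h := 1%g).
  rewrite /prop_for /continuous_at mulg1 => c.
  have := near_ichart (mem_dom (1%g : G)) (c _ (near_dom (mem_dom g0))).
  by apply: filterS => x gx; rewrite /chart_projection /= chartK.
by rewrite /= chartK ?mulg1//; exact: mem_dom.
Qed.

Lemma chart_projection_id : chart_projection e = chart q0 q0.
Proof.
by rewrite /chart_projection chartK ?mulg1//; exact: mem_dom.
Qed.

(* The left-invariant field of [v], projected to the chart of [H] at [q0]. *)
Definition projected_frame (x v : 'rV[R]_nG) : 'rV[R]_nH :=
  'd chart_projection x (left_frame (G := G) x v).

Lemma linear_projected_frame x : linear (projected_frame x).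
Proof.
move=> k u v; rewrite /projected_frame linear_left_frame; exact: linearP.
Qed.

Lemma smooth_projected_frame v : smooth_near (projected_frame ^~ v) e.
Proof.
apply: (@smooth_near_apply _ _ _ _ (fun y => 'd chart_projection y)).
- by move=> y; exact: linearP.
- by move=> w; apply: smooth_near_diff; exact: smooth_chart_projection.
- exact: smooth_left_frame.
Qed.

(** By [near_left_frame] for the chart at [q0] composed with [h |-> prj (g0 * h)], the coordinate
    derivative acquires its intrinsic meaning. *)
Lemma projected_frame_near : \forall x \near e,
  dom q0 (prj (g0 * ichart (1%g : G) x)%g) /\
  forall v, projected_frame x v =
    to_chart q0 (prj (g0 * ichart (1%g : G) x)%g)
      (dmap prj (g0 * ichart (1%g : G) x)%g
        (dleft (g0 * ichart (1%g : G) x)%g 1%g v)).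
Proof.
have c h : {for h, continuous (fun x : G => prj (g0 * x)%g)}.
  have c1 := @continuous_lmul _ _ _ g0 h.
  have c2 := @continuous_projection (g0 * h)%g.
  exact: (continuous_comp c1 c2).
have cd : \forall x \near e, dom q0 (prj (g0 * ichart (1%g : G) x)%g).
  have d1 : dom q0 (prj (g0 * 1)%g) by rewrite mulg1; exact: mem_dom.
  exact: (near_ichart (mem_dom (1%g : G)) (c _ _ (near_dom d1))).
apply: filterS2 near_left_frame cd => x; set k := ichart _ x => Hx kd.
split=> // v.
have dF : is_mdiff k (chart q0 \o (fun x => prj (g0 * x)%g))
   (to_chart q0 (prj (g0 * k)%g) \o (dmap prj (g0 * k)%g \o dleft g0 k)).
  exact: (is_mdiff_comp (c k) (is_mdiff_projection_lmul g0 k) (is_mdiff_chart kd)).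
transitivity (to_chart q0 (prj (g0 * k)%g)
    (dmap prj (g0 * k)%g (dleft g0 k (dleft k 1%g v)))).
  exact: (esym (Hx _ _ _ dF v)).
by have := dleft_comp g0 k 1%g v; rewrite mulg1 => ->.
Qed.

Lemma projected_frame1 v :
  projected_frame e v = dmap prj g0 (dleft g0 1%g v).
Proof.
have := nbhs_singleton projected_frame_near.
rewrite chartK; last exact: mem_dom.
by rewrite mulg1 => -[_ ->]; rewrite to_chart_id.
Qed.

Lemma projected_frame_id v : projected_frame e v = 'd chart_projection e v.
Proof. by rewrite /projected_frame left_frame_id. Qed.

Local Opaque projected_frame.

Definition chart_metric (y u w : 'rV[R]_nH) : R^o :=
  metH (ichart q0 y) (chart_field q0 u (ichart q0 y))
    (chart_field q0 w (ichart q0 y)).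

Lemma chart_metric_id u w : chart_metric (chart q0 q0) u w = metH q0 u w.
Proof.
rewrite /chart_metric /chart_field chartK; last exact: mem_dom.
by rewrite !of_chart_id.
Qed.

Lemma chart_metricE u w :
  chart_metric (chart_projection e) u w = metH q0 u w.
Proof. by rewrite chart_projection_id chart_metric_id. Qed.

Lemma linear_chart_metric y w : linear (fun u => chart_metric y u w).
Proof.
move=> k u v; rewrite /chart_metric -(metP hmetH); congr (metH _ _ _).
exact: linearP.
Qed.

Lemma chart_metricC y u w : chart_metric y u w = chart_metric y w u.
Proof. exact: (metC hmetH). Qed.

Lemma chart_metric_projection a b : Hor metG prj 1%g a ->
  metH q0 (projected_frame e a) (projected_frame e b) = metG 1%g a b.
Proof.
move=> ha; rewrite !projected_frame1 met_projection; last exact: Hor_left.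
by have := met_dleft g0 1%g a b; rewrite mulg1.
Qed.

(** Both sides equal the metric at [prj 1] of the projections of [u] and [v], by invariance under
    [g0 * ichart 1 x]. *)
Lemma chart_metric_isometry u v : \forall x \near e,
  chart_metric (chart_projection x) (projected_frame x u) (projected_frame x v)
  = chart_metric (chart_projection e) ('d chart_projection e u)
      ('d chart_projection e v).
Proof.
have key : \forall x \near e, chart_metric (chart_projection x)
    (projected_frame x u) (projected_frame x v) =
    metH (prj 1%g) (dmap prj 1%g u) (dmap prj 1%g v).
  apply: filterS projected_frame_near => x [kd Hx].
  rewrite /chart_metric /chart_field /chart_projection chartK// !Hx.
  rewrite !to_chartK//.
  have := metH_invariant (g0 * ichart (1%g : G) x)%g 1%g u v.
  by rewrite mulg1.
have k1 := nbhs_singleton key; apply: filterS key => x ->.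
by rewrite -k1 !projected_frame_id.
Qed.

Lemma is_diff_chart_metric u w :
  is_diff (chart_projection e) (fun y => chart_metric y u w)
    (dfun (fun q => metH q (chart_field q0 u q) (chart_field q0 w q)) q0).
Proof.
rewrite chart_projection_id; apply: smooth_near_is_diff.
have [_ _ _ sm] := hmetH.
exact: (sm q0 _ _ (smooth_chart_field q0 u) (smooth_chart_field q0 w)).
Qed.

End BasePoint.

End HomogeneousSpace.

(** * Uniqueness of horizontal lifts *)

Lemma is_deriv_withinB {R : realType} (W : normedModType R) (I : set R)
    (c1 c2 : R -> W) t v1 v2 :
  is_deriv_within I c1 t v1 -> is_deriv_within I c2 t v2 ->
  is_deriv_within I (fun s => c1 s - c2 s) t (v1 - v2).
Proof.
move=> d1 d2; rewrite /is_deriv_within.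
have -> : (fun s => (s - t)^-1 *: (c1 s - c2 s - (c1 t - c2 t))) =
    (fun s => (s - t)^-1 *: (c1 s - c1 t)) -
    (fun s => (s - t)^-1 *: (c2 s - c2 t)).
  apply/funext => s; rewrite !fctE -scalerBr; congr (_ *: _).
  by rewrite !opprD !opprK addrACA.
exact: cvgB.
Qed.

Lemma half_absorb {R : realType} (p x y : R) :
  x <= p * y + 2^-1 * x -> x <= 2 * p * y.
Proof. by move=> h; lra. Qed.

Section HorizontalLifts.
Context {R : realType} {nG nH : nat} {G : lieGroupType R nG}
  {H : manifoldType R nH} {K : set G} {prj : G -> H} {Phi : G -> H -> H}
  {metG : G -> 'rV[R]_nG -> 'rV[R]_nG -> R}
  {metH : H -> 'rV[R]_nH -> 'rV[R]_nH -> R}.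
Context (hH : homogeneous_space K prj Phi) (hmetG : riemannian_metric metG)
  (hmetG_inv : left_invariant_metric metG)
  (hmetH : riemannian_metric metH) (hpi : riemannian_submersion metG metH prj).
Notation e := (chart (1%g : G) (1%g : G)).
Local Notation lframe := (left_frame (G := G)).

Lemma projection_velocity (I : set R) (c : R -> G) t v : I t ->
  is_velocity I c t v -> is_velocity I (prj \o c) t (dmap prj (c t) v).
Proof.
move=> It; apply: is_velocity_comp => //.
  exact: (continuous_projection hH).
exact: (is_mdiff_projection hH).
Qed.

Lemma translated_velocity (g0 : G) : \forall y \near e,
  forall (I : set R) (c : R -> G) t xi, I t -> dom (1%g : G) (g0^-1 * c t)%g ->
  chart (1%g : G) (g0^-1 * c t)%g = y ->
  is_velocity I c t (dleft (c t) 1%g xi) ->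
  is_deriv_within I (fun s => chart (1%g : G) (g0^-1 * c s)%g) t (lframe y xi).
Proof.
apply: filterS near_left_inv_field => y Hy I c t xi It dt cy vc.
have vk : is_velocity I (fun s => (g0^-1 * c s)%g) t
    (dleft g0^-1%g (c t) (dleft (c t) 1%g xi)).
  exact: (is_velocity_comp It (@continuous_lmul _ _ _ _ _) (is_mdiff_lmul _ _) vc).
have := is_mdiff_deriv It (is_mdiff_chart dt) vk.
have -> : dleft g0^-1%g (c t) (dleft (c t) 1%g xi) =
    left_inv_field xi (g0^-1 * c t)%g.
  by have := dleft_comp g0^-1%g (c t) 1%g xi; rewrite mulg1.
by have := Hy xi; rewrite -cy chartK// => ->.
Qed.

Lemma projected_velocity (g0 : G) : \forall y \near e,
  forall (I : set R) (c : R -> G) t xi, I t -> dom (1%g : G) (g0^-1 * c t)%g ->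
  chart (1%g : G) (g0^-1 * c t)%g = y ->
  is_velocity I c t (dleft (c t) 1%g xi) ->
  is_deriv_within I (fun s => chart (prj g0) (prj (c s))) t
    (projected_frame (prj := prj) g0 y xi).
Proof.
apply: filterS (projected_frame_near hH g0) => y Hy I c t xi It dt cy.
move/(projection_velocity It) => vq; move: Hy.
rewrite -cy chartK// mulVKg => -[dq ->].
exact: (is_mdiff_deriv It (is_mdiff_chart dq) vq).
Qed.

Context (E : {vspace 'rV[R]_nG}) (hE : forall v, v \in E -> Hor metG prj 1%g v).

(* In left trivialisation, two lifts [c1], [c2] of the same curve satisfy
   [A(c1) xi1 = A(c2) xi2], where [A] is Lipschitz and injective on the
   horizontal space; hence [xi1 - xi2 = O(c1 - c2)]. *)
Lemma horizontal_lift_unique_local (a b t0 : R) (c1 c2 : R -> G)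
    (xi1 xi2 : R -> 'rV[R]_nG) :
  a < b -> a <= t0 -> t0 < b -> c1 t0 = c2 t0 ->
  (forall t, t \in `[a, b] -> prj (c1 t) = prj (c2 t)) ->
  (forall t, t \in `[a, b] ->
    is_velocity `[a, b] c1 t (dleft (c1 t) 1%g (xi1 t)) /\ xi1 t \in E) ->
  (forall t, t \in `[a, b] ->
    is_velocity `[a, b] c2 t (dleft (c2 t) 1%g (xi2 t)) /\ xi2 t \in E) ->
  xi1 @ within `[a, b] (nbhs t0) --> xi1 t0 ->
  exists2 t1, t0 < t1 & forall s, t0 <= s <= t1 -> s \in `[a, b] -> c1 s = c2 s.
Proof.
move=> ab at0 t0b c12 prj12 v1 v2 cxi; set g0 := c1 t0.
pose I := `[a, b]%classic : set R.
have It0 : t0 \in `[a, b] by rewrite in_itv /= at0 ltW.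
pose x1 s := chart (1%g : G) (g0^-1 * c1 s)%g.
pose x2 s := chart (1%g : G) (g0^-1 * c2 s)%g.
pose PF := projected_frame (prj := prj) g0.
have linPF y : linear (PF y) by exact: linear_projected_frame.
have smPF w : smooth_near (PF ^~ w) e by exact: (smooth_projected_frame hH).
pose PFM := GRing.isLinear.Build _ _ _ _ _ (linPF e).
pose PFL : {linear 'rV[R]_nG -> 'rV[R]_nH} := HB.pack (PF e) PFM.
have [k k0 Hk] : exists2 k, 0 < k & forall v, v \in E -> `|v| <= k * `|PF e v|.
  apply: (@injective_on_bound _ _ _ E PFL) => v vE.
  rewrite /= /PF (projected_frame1 hH) => v0.
  have hv := Hor_left hH hmetG_inv (g := g0) (hE vE).
  have l0 := Hor_dmap_inj hmetG hmetH hpi hv v0.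
  by rewrite -[v](dleftK g0) l0; exact: linear0.
have near_diff m (b' : 'rV[R]_nG -> 'rV[R]_nG -> 'rV[R]_m) r :
    (forall y, linear (b' y)) -> (forall w, smooth_near (b' ^~ w) e) -> 0 < r ->
    \forall y \near e, forall w, `|b' y w - b' e w| <= r * `|w|.
  move=> linb smb r0.
  pose A y w := b' y w - b' e w.
  have linA y : linear (A y).
    by move=> p u v; rewrite /A !linb scalerBr opprD addrACA.
  have A0 w r' : 0 < r' -> \forall y \near e, `|A y w| <= r'.
    move=> r'0; have [dw _] := smooth_near_is_diff (smb w).
    have /cvgrPdist_le/(_ r' r'0) := differentiable_continuous dw.
    by apply: filterS => y; rewrite distrC.
  have := near_linear_bound (@nbhs_filter _ e) linA A0 r0; exact.
(* Multiplied by [k], this tolerance leaves half of [|zeta|] below, which is absorbed on the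
   left. *)
have k20 : 0 < (2 * k)^-1 by rewrite invr_gt0 mulr_gt0.
have N1 := near_diff _ PF _ linPF smPF k20.
have N2 := near_diff _ lframe 1 (linear_left_frame (G := G))
  (smooth_left_frame (G := G)) ltr01.
have [L L0 N3] := smooth_family_lipschitz linPF smPF.
have [L' L'0 N4] := smooth_family_lipschitz (linear_left_frame (G := G))
  (smooth_left_frame (G := G)).
have N5 := @filterI _ _ (nbhs_filter e) _ _ (translated_velocity g0) (projected_velocity g0).
(* Only [xi1] is bounded directly; [xi2] enters solely through the difference [xi1 - xi2]. *)
pose M := `|xi1 t0| + 1.
have NM : \forall s \near t0, I s -> `|xi1 s| <= M.
  have /cvgrPdist_le/(_ 1 ltr01) := cxi; rewrite near_withinE.
  apply: filterS => s /[apply] H1; rewrite -[xi1 s](subrK (xi1 t0)).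
  by rewrite (le_trans (ler_normD _ _))// [leRHS]addrC lerD// distrC.
have near_curve (c : R -> G) (P : set G) :
    c @ within I (nbhs t0) --> g0 -> (\forall h \near (1%g : G), P h) ->
    \forall s \near t0, I s -> P (g0^-1 * c s)%g.
  move=> cc nP; have := @continuous_lmul _ _ _ g0^-1%g g0.
  rewrite /prop_for /continuous_at mulVg => cl.
  exact: (cvg_comp _ _ cc cl _ nP).
have cc1 : c1 @ within I (nbhs t0) --> g0 by have [[]] := v1 t0 It0.
have cc2 : c2 @ within I (nbhs t0) --> g0 by rewrite /g0 c12; have [[]] := v2 t0 It0.
have near_pair (P : set ('rV[R]_nG * 'rV[R]_nG)) :
    (\forall z \near (e, e), P z) -> \forall s \near t0, I s -> P (x1 s, x2 s).
  move=> [[A B] [/= nA nB] AB].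
  have HA := near_curve c1 _ cc1 (near_chart (mem_dom (1%g : G)) nA).
  have HB := near_curve c2 _ cc2 (near_chart (mem_dom (1%g : G)) nB).
  apply: filterS2 HA HB => s sA sB Is; apply: AB; split.
    exact: sA.
  exact: sB.
have ND := @filterI _ _ (nbhs_filter t0) _ _ (near_curve c1 _ cc1 (near_dom (mem_dom (1%g : G))))
                   (near_curve c2 _ cc2 (near_dom (mem_dom (1%g : G)))).
have NP := @filterI _ _ (nbhs_filter t0) _ _ (near_pair _ N3) (near_pair _ N4).
have NE1 := near_curve c1 _ cc1 (near_chart (mem_dom (1%g : G))
  (@filterI _ _ (nbhs_filter e) _ _ N5 N2)).
have NE2 := near_curve c2 _ cc2 (near_chart (mem_dom (1%g : G))
  (@filterI _ _ (nbhs_filter e) _ _ N5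
    (@filterI _ _ (nbhs_filter e) _ _ N1 N2))).
have [r r0 Hr] : exists2 r, 0 < r & forall s, `|s - t0| < r -> I s ->
    [/\ `|xi1 s| <= M,
        dom (1%g : G) (g0^-1 * c1 s)%g /\ dom (1%g : G) (g0^-1 * c2 s)%g,
        (forall w, `|PF (x1 s) w - PF (x2 s) w| <= L * `|x1 s - x2 s| * `|w|) /\
        (forall w, `|lframe (x1 s) w - lframe (x2 s) w| <= L' * `|x1 s - x2 s| * `|w|),
        is_deriv_within I x1 s (lframe (x1 s) (xi1 s)) /\
        is_deriv_within I x2 s (lframe (x2 s) (xi2 s)) /\
        PF (x1 s) (xi1 s) = PF (x2 s) (xi2 s) &
        (forall w, `|PF (x2 s) w - PF e w| <= (2 * k)^-1 * `|w|) /\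
        (forall w, `|lframe (x2 s) w - lframe e w| <= 1 * `|w|)].
  apply/nbhs_distP.
  have N := @filterI _ _ (nbhs_filter t0) _ _ NM
    (@filterI _ _ (nbhs_filter t0) _ _ ND
    (@filterI _ _ (nbhs_filter t0) _ _ NP
    (@filterI _ _ (nbhs_filter t0) _ _ NE1 NE2))).
  apply: filterS N => s [sM [[sD1 sD2] [[sP1 sP2] [sE1 sE2]]]] Is.
  have {}sD1 := sD1 Is; have {}sD2 := sD2 Is.
  have [[T1 P1] _] := sE1 Is; have [[T2 P2] [Q1 Q2]] := sE2 Is.
  have [vs1 _] := v1 s Is; have [vs2 _] := v2 s Is.
  split; [exact: sM|by []|by split; [exact: sP1|exact: sP2]| |by []].
  split; first exact: T1 _ _ _ _ Is sD1 erefl vs1.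
  split; first exact: T2 _ _ _ _ Is sD2 erefl vs2.
  (* Both lifts project to the same curve, so these are two derivatives of one curve in the chart of
     [H]. *)
  have d1 := P1 _ _ _ _ Is sD1 erefl vs1.
  have d2 := P2 _ _ _ _ Is sD2 erefl vs2.
  apply: (is_deriv_within_unique ab Is d1).
  apply: is_deriv_within_near d2 => //.
  by near=> s' => Is'; rewrite prj12.
(* The velocity difference has two sources: the frame moving from [x2] to [x1] at fixed [xi1],
   giving [L' * M], and [zeta = xi1 - xi2], of size [2 * k * L * M] times the distance and at most
   doubled by the frame. *)
pose C := L' * M + 2 * (2 * k * (L * M)).
have M0 : 0 <= M by rewrite /M addr_ge0.
have C0 : 0 <= C by rewrite /C addr_ge0// !mulr_ge0// ltW.
have C1 : 0 < C + 1 by rewrite ltr_wpDl.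
(* The last entry ensures [C * d < 1], as [gronwall_zero] requires; [r / 2] keeps the closed
   interval inside the open neighbourhood. *)
pose d := Num.min (b - t0) (Num.min (r / 2) (2^-1 / (C + 1))).
have d0 : 0 < d by rewrite !lt_min subr_gt0 t0b !divr_gt0// invr_gt0.
have [db [dr dC]] : d <= b - t0 /\ d <= r / 2 /\ d <= 2^-1 / (C + 1).
  by split; [|split]; rewrite /d !ge_min lexx ?orbT.
exists (t0 + d); first by rewrite ltrDl.
have close s : t0 <= s <= t0 + d -> `|s - t0| < r /\ s \in `[a, b].
  move=> /andP[s0 s1]; split; last first.
    by rewrite in_itv /= (le_trans at0 s0) (le_trans s1)// addrC -lerBrDr.
  rewrite ger0_norm ?subr_ge0// (@le_lt_trans _ _ d) ?lerBlDl//.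
  by rewrite (le_lt_trans dr)// ltr_pdivrMr// ltr_pMr// ltr1n.
have key : forall s, t0 <= s <= t0 + d -> x1 s - x2 s = 0.
  apply: (@gronwall_zero _ _ a b t0 (t0 + d) C (fun s => x1 s - x2 s)
    (fun s => lframe (x1 s) (xi1 s) - lframe (x2 s) (xi2 s))) => //.
  - by rewrite lerDl ltW.
  - by rewrite addrC -lerBrDr.
  - rewrite addrC addKr; apply: (@le_lt_trans _ _ (C * (2^-1 / (C + 1)))).
      by rewrite ler_wpM2l.
    rewrite mulrA ltr_pdivrMr// mul1r; move: C0; clearbody C => C0; lra.
  - move=> s /close[sr sI]; have [_ _ _ [e1 [e2 _]] _] := Hr s sr sI.
    exact: is_deriv_withinB e1 e2.
  - move=> s /close[sr sI]; have [hM _ [hL hL'] [_ [_ hPF]] [h1 h2]] := Hr s sr sI.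
    set z := x1 s - x2 s.
    have zE : xi1 s - xi2 s \in E by rewrite rpredB//; [case: (v1 s sI)|case: (v2 s sI)].
    set zeta := xi1 s - xi2 s in zE.
    have linD y u w : PF y (u - w) = PF y u - PF y w.
      by rewrite -scaleN1r addrC linPF scaleN1r addrC.
    have lfD y u w : lframe y (u - w) = lframe y u - lframe y w.
      by rewrite -scaleN1r addrC linear_left_frame scaleN1r addrC.
    (* Since [PF (x1 s) (xi1 s) = PF (x2 s) (xi2 s)], the left-hand vector is a difference of [PF]
       at two points, applied to [xi1 s] alone. *)
    have b1 : `|PF (x2 s) zeta| <= L * `|z| * M.
      rewrite /zeta linD -hPF -normrN opprB (le_trans (hL _))//.
      by rewrite ler_wpM2l// mulr_ge0.
    have b2 : `|zeta| <= 2 * k * (L * `|z| * M).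
      have H1 : `|PF e zeta| <= L * `|z| * M + (2 * k)^-1 * `|zeta|.
        rewrite -[PF e zeta](subrK (PF (x2 s) zeta)) (le_trans (ler_normD _ _))//.
        by rewrite addrC lerD// distrC.
      have := le_trans (Hk _ zE) (ler_wpM2l (ltW k0) H1).
      rewrite mulrDr [X in _ + X]mulrA.
      have -> : k * (2 * k)^-1 = 2^-1 by field; rewrite gt_eqF.
      exact: half_absorb.
    have b3 : `|lframe (x2 s) zeta| <= 2 * `|zeta|.
      rewrite -[lframe _ zeta](subrK (lframe e zeta)) (le_trans (ler_normD _ _))//.
      rewrite {2}left_frame_id mulr2n mulrDl mul1r lerD//.
      by rewrite (le_trans (h2 _))// mul1r.
    have -> : lframe (x1 s) (xi1 s) - lframe (x2 s) (xi2 s) =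
        lframe (x1 s) (xi1 s) - lframe (x2 s) (xi1 s) + lframe (x2 s) zeta.
      by rewrite /zeta lfD addrA subrK.
    rewrite (le_trans (ler_normD _ _))//.
    have -> : C * `|z| = L' * `|z| * M + 2 * (2 * k * (L * `|z| * M)).
      by rewrite /C; ring.
    rewrite lerD//; first by rewrite (le_trans (hL' _))// ler_wpM2l// mulr_ge0.
    by rewrite (le_trans b3)// ler_pM2l.
  - by rewrite /x1 /x2 -c12 subrr.
move=> s st sI; have [sr _] := close s st.
have [_ [D1 D2] _ _ _] := Hr s sr sI.
have /eqP := key s st; rewrite subr_eq0 => /eqP/(congr1 (ichart (1%g : G))).
by rewrite /x1 /x2 !chartK// => /mulgI.
Unshelve. all: by end_near. Qed.

(** Let [t0] be the infimum of the times of disagreement. The curves agree at [t0], by hypothesis if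
    [t0 = a] and otherwise by continuity from the left in a Hausdorff space; local uniqueness to the
    right of [t0] contradicts the infimum. *)
Lemma horizontal_lift_unique (a b : R) (c1 c2 : R -> G)
    (xi1 xi2 : R -> 'rV[R]_nG) :
  a < b -> c1 a = c2 a ->
  (forall t, t \in `[a, b] -> prj (c1 t) = prj (c2 t)) ->
  (forall t, t \in `[a, b] ->
    is_velocity `[a, b] c1 t (dleft (c1 t) 1%g (xi1 t)) /\ xi1 t \in E) ->
  (forall t, t \in `[a, b] ->
    is_velocity `[a, b] c2 t (dleft (c2 t) 1%g (xi2 t)) /\ xi2 t \in E) ->
  (forall t, t \in `[a, b] -> xi1 @ within `[a, b] (nbhs t) --> xi1 t) ->
  forall t, t \in `[a, b] -> c1 t = c2 t.
Proof.
move=> ab ca prj12 v1 v2 cxi t tab; apply: contrapT => ct.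
pose T := [set s | s \in `[a, b] /\ c1 s <> c2 s].
have Tt : T t by [].
have infT : has_inf T.
  by split; [exists t|exists a => s [+ _]]; rewrite ?in_itv //= => /andP[].
set t0 := inf T.
have at0 : a <= t0.
  by apply: lb_le_inf; [exists t|move=> s [+ _]; rewrite in_itv /= => /andP[]].
have t0t : t0 <= t by apply: ge_inf => //; exact: infT.2.
have tb : t <= b by move: tab; rewrite in_itv /= => /andP[].
have t0ab : t0 \in `[a, b] by rewrite in_itv /= at0 (le_trans t0t).
have below s : a <= s -> s < t0 -> c1 s = c2 s.
  move=> as_ st0; apply: contrapT => cs.
  suff : t0 <= s by rewrite leNgt st0.
  apply: ge_inf; first exact: infT.2.
  split=> //; rewrite in_itv /= as_ (le_trans (ltW st0))//.
  by move: t0ab; rewrite in_itv /= => /andP[].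
have c12 : c1 t0 = c2 t0.
  move: at0; rewrite le_eqVlt => /orP[/eqP <- //|at0].
  have left_lim (c : R -> G) v : is_velocity `[a, b] c t0 v ->
      c @ t0^'- --> c t0.
    move=> [cc _]; apply: cvg_trans cc; apply: cvg_app.
    move=> P nP; have {}nP : \forall u \near t0^'-, u \in `[a, b] -> P u.
      rewrite /at_left near_withinE.
      have nP1 : \forall u \near t0, `[a, b]%classic u -> P u := nP.
      by apply: filterS nP1 => u Pu _; exact: Pu.
    near=> s.
    have : s \in `[a, b].
      rewrite in_itv /=; apply/andP; split.
        by near: s; exact: nbhs_left_ge.
      move: t0ab; rewrite in_itv /= => /andP[_]; apply: le_trans.
      by near: s; exact: nbhs_left_le.
    by near: s.
  have l1 := left_lim _ _ (v1 t0 t0ab).1.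
  have l2 := left_lim _ _ (v2 t0 t0ab).1.
  apply: (cvg_unique (@hausdorff_manifold R nG G) l1).
  apply: cvg_trans l2; apply: near_eq_cvg; near=> s; apply/esym; apply: below.
    by near: s; exact: nbhs_left_ge.
  by near: s; exact: nbhs_left_lt.
have t0b : t0 < b.
  rewrite lt_neqAle; apply/andP; split; last by rewrite (le_trans t0t).
  apply/eqP => t0b; apply: ct; rewrite -(_ : t0 = t)//.
  by apply/eqP; rewrite eq_le t0t t0b tb.
have [t1 t01 Ht1] := horizontal_lift_unique_local ab at0 t0b c12 prj12 v1 v2
  (cxi t0 t0ab).
have : t1 <= t0.
  apply: lb_le_inf; first by exists t.
  move=> s [sab cs]; rewrite leNgt; apply/negP => st1; apply: cs.
  have [st0|t0s] := ltP s t0.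
    by apply: below st0; move: sab; rewrite in_itv /= => /andP[].
  by apply: Ht1 => //; rewrite t0s ltW.
by rewrite leNgt t01.
Unshelve. all: by end_near. Qed.

End HorizontalLifts.

(** * The equation satisfied by the projected curve *)

Section ProjectedAcceleration.
Context {R : realType} {nG nH : nat} {G : lieGroupType R nG}
  {H : manifoldType R nH} {K : set G} {prj : G -> H} {Phi : G -> H -> H}
  {metG : G -> 'rV[R]_nG -> 'rV[R]_nG -> R}
  {metH : H -> 'rV[R]_nH -> 'rV[R]_nH -> R}
  {nablaG : G -> 'rV[R]_nG -> (G -> 'rV[R]_nG) -> 'rV[R]_nG}
  {nablaH : H -> 'rV[R]_nH -> (H -> 'rV[R]_nH) -> 'rV[R]_nH}.
Context (hH : homogeneous_space K prj Phi) (hmetG : riemannian_metric metG)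
  (hmetG_inv : left_invariant_metric metG)
  (hmetH : riemannian_metric metH) (hpi : riemannian_submersion metG metH prj)
  (hnablaG : levi_civita metG nablaG) (hnablaH : levi_civita metH nablaH).
Notation e := (chart (1%g : G) (1%g : G)).
Local Notation lframe := (left_frame (G := G)).
Local Opaque dmap dleft.

Lemma projected_frame_surj g0 w :
  exists eta, projected_frame (prj := prj) g0 e eta = w.
Proof.
have [v vw] := Tmap_surj hH g0 w; exists (dleft g0^-1%g g0 v).
rewrite (projected_frame1 hH) dleftVK; exact: vw.
Qed.

(** The vector paired on the left is the covariant acceleration of the projected curve when [xi] is
    held fixed. *)
Lemma christoffel_projection g0 xi eta :
  metH (prj g0)
    ('d (fun x => 'd (chart_projection (prj := prj) g0) x xi) e xi +
     'd (chart_projection (prj := prj) g0) e ('d (fun x => lframe x xi) e xi) +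
     nablaH (prj g0) (projected_frame (prj := prj) g0 e xi)
       (chart_field (prj g0) (projected_frame (prj := prj) g0 e xi)))
    (projected_frame (prj := prj) g0 e eta) =
  metH (prj g0) (projected_frame (prj := prj) g0 e xi)
    (projected_frame (prj := prj) g0 e ('d (fun x => lframe x xi) e eta -
                                        'd (fun x => lframe x eta) e xi)).
Proof.
have dlf v : is_diff e (lframe ^~ v) ('d (fun x => lframe x v) e).
  exact: smooth_near_is_diff (smooth_left_frame v).
have tp : twice_diff (chart_projection (prj := prj) g0) e.
  exact: smooth_near_twice_diff (smooth_chart_projection hH g0).
have := moving_frame_christoffel
  (left_frame_id (G := G)) dlf tp (linear_chart_metric hmetH g0)
  (chart_metricC hmetH g0) (is_diff_chart_metric hmetH g0)
  (chart_metric_isometry hH hmetG hmetG_inv hpi g0) xi eta.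
rewrite !chart_metricE => MF.
rewrite (projected_frame_id g0 xi) (projected_frame_id g0 eta).
rewrite (projected_frame_id g0 (_ - _)) -MF.
rewrite (metDl hmetH) (levi_civita_chart_field _ hmetH hnablaH).
exact: addrA.
Qed.

(** [acc] is given through its pairings with the vectors [dmap prj (g t) (dleft (g t) 1 eta)], which
    fill the tangent space of [H]. The pairings split into the part of [dxi], moved to [G] by its
    horizontality, and the part with [xi] frozen, given by [christoffel_projection] and
    [nabla_g_adjoint]. *)
Lemma covariant_deriv_projection (a b : R) (g : R -> G)
    (xi : R -> 'rV[R]_nG) t dxi acc :
  a < b -> t \in `[a, b] ->
  (forall s, s \in `[a, b] -> is_velocity `[a, b] g s (dleft (g s) 1%g (xi s))) ->
  is_deriv_within `[a, b] xi t dxi ->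
  Hor metG prj 1%g (xi t) -> Hor metG prj 1%g dxi ->
  (forall eta, metH (prj (g t)) acc (dmap prj (g t) (dleft (g t) 1%g eta)) =
               metG 1%g (dxi + nabla_g nablaG (xi t) (xi t)) eta) ->
  is_covariant_deriv nablaH `[a, b] (prj \o g)
    (fun s => dmap prj (g s) (dleft (g s) 1%g (xi s))) t acc.
Proof.
move=> ab It vg dx hxi hdxi accP; set g0 := g t; pose I := `[a, b]%classic : set R.
pose p := chart_projection (prj := prj) g0.
pose Bm v := 'd (fun x => lframe x v) e.
have dlf v : is_diff e (lframe ^~ v) (Bm v).
  exact: smooth_near_is_diff (smooth_left_frame v).
have tp : twice_diff p e.
  exact: smooth_near_twice_diff (smooth_chart_projection hH g0).
pose x s := chart (1%g : G) (g0^-1 * g s)%g.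
have xt : x t = e by rewrite /x mulVg.
have k1 : dom (1%g : G) (g0^-1 * g t)%g by rewrite mulVg; exact: mem_dom.
have dxx : is_deriv_within I x t (xi t).
  have := nbhs_singleton (translated_velocity g0) I g t (xi t) It k1 xt (vg t It).
  by rewrite left_frame_id.
have dA := is_deriv_frame (linear_left_frame (G := G))
  (left_frame_id (G := G)) dlf tp xt dxx dx.
set dZ := _ + _ in dA.
pose v := dmap prj g0 (dleft g0 1%g (xi t)).
have vE : v = 'd p e (xi t).
  by rewrite -[RHS](projected_frame_id (prj := prj) g0) (projected_frame1 hH).
exists v, dZ; split.
- exact: (projection_velocity hH It (vg t It)).
- apply: is_deriv_within_near dA => //.
  have cg : g @ within I (nbhs t) --> g0 by have [] := vg t It.
  have := @continuous_lmul _ _ _ g0^-1%g g0.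
  rewrite /prop_for /continuous_at mulVg => cl.
  have N1 : \forall s \near t, I s -> dom (1%g : G) (g0^-1 * g s)%g.
    exact: (cvg_comp _ _ cg cl _ (near_dom (mem_dom (1%g : G)))).
  have N2 := cvg_comp _ _ cg cl _ (near_chart (mem_dom (1%g : G))
    (projected_frame_near hH g0)).
  apply: filterS2 N1 N2 => s D1 D2 Is.
  have [_ +] := D2 Is; rewrite chartK ?mulVKg; last exact: D1.
  exact.
apply: (met_inj hmetH (p := prj g0)) => w.
have [eta <-] := projected_frame_surj g0 w.
rewrite [in LHS](projected_frame1 hH) accP !(metDl hmetG).
have pE u : 'd p e u = projected_frame (prj := prj) g0 e u.
  exact: esym (projected_frame_id _ _).
have Ev : v = projected_frame (prj := prj) g0 e (xi t) by rewrite vE pE.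
have C := christoffel_projection g0 (xi t) eta.
have C1 := chart_metric_projection hH hmetG hmetG_inv hpi g0
  ('d (fun x => lframe x (xi t)) e eta - 'd (fun x => lframe x eta) e (xi t)) hxi.
have C2 := chart_metric_projection hH hmetG hmetG_inv hpi g0 eta hdxi.
have C3 := nabla_g_adjoint hmetG hnablaG hmetG_inv (xi t) eta.
rewrite C3 -C1 -C2 -C addrC -(metDl hmetH); congr (metH _ _ _).
rewrite -Ev -pE /dZ addrAC; congr (_ + _).
Qed.

End ProjectedAcceleration.

(** * Change of time origin, from [[a, b]] to [[0, b - a]] *)

Section TimeShift.
Context {R : realType}.

Lemma near_shiftD (P : set R) (a t : R) :
  (\forall s \near (a + t), P s) -> \forall s \near t, P (a + s).
Proof.
move=> /nbhs_distP[d d0 dP]; apply/nbhs_distP; exists d => // s sd.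
by apply: dP; rewrite opprD addrACA subrr add0r.
Qed.

Context (a b : R).

Lemma itv_shift s : (s \in `[0, b - a]) = (a + s \in `[a, b]).
Proof. by rewrite !in_itv /= lerDl lerBrDl. Qed.

Lemma is_deriv_within_shift (W : normedModType R) (c : R -> W) t v :
  is_deriv_within `[a, b] c (a + t) v ->
  is_deriv_within `[0, b - a] (fun s => c (a + s)) t v.
Proof.
move=> /is_deriv_withinP dc; apply/is_deriv_withinP => r r0.
apply: filterS (near_shiftD (dc r r0)) => s Hs Is.
have := Hs; rewrite opprD addrACA subrr add0r; apply.
by move: Is; rewrite /= itv_shift.
Qed.

Lemma is_velocity_shift n (M : manifoldType R n) (c : R -> M) t v :
  is_velocity `[a, b] c (a + t) v ->
  is_velocity `[0, b - a] (fun s => c (a + s)) t v.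
Proof.
move=> [cc dc]; split; last exact: is_deriv_within_shift dc.
move=> A nA; have H : \forall s \near (a + t), `[a, b]%classic s -> A (c s).
  exact: (cc A nA).
have := near_shiftD H; rewrite /within /=; apply: filterS => s Hs Is.
by apply: Hs; move: Is; rewrite /= itv_shift.
Qed.

End TimeShift.

Local Opaque dmap dleft.

Theorem theorem6 (R : realType) (nG nH m : nat)
  (G : lieGroupType R nG) (H : manifoldType R nH)
  (K : set G) (pi : G -> H) (Phi : G -> H -> H)
  (metG : G -> 'rV[R]_nG -> 'rV[R]_nG -> R)
  (metH : H -> 'rV[R]_nH -> 'rV[R]_nH -> R)
  (nablaG : G -> 'rV[R]_nG -> (G -> 'rV[R]_nG) -> 'rV[R]_nG)
  (nablaH : H -> 'rV[R]_nH -> (H -> 'rV[R]_nH) -> 'rV[R]_nH)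
  (U : set 'rV[R]_m)
  (D : H -> {vspace 'rV[R]_nH}) (d : {vspace 'rV[R]_nG})
  (Y : 'I_m -> H -> 'rV[R]_nH) (f : 'I_m -> 'rV[R]_nG)
  (V : H -> R^o)
  (u : subvs_of d -> 'rV[R]_m)
  (a b : R) (g : R -> G) (xi : R -> 'rV[R]_nG)
  (hG : connected [set: G])
  (hK : closed_subgroup K)
  (hH : homogeneous_space K pi Phi)
  (hmetG : riemannian_metric metG)
  (hmetG_inv : left_invariant_metric metG)
  (hmetH : riemannian_metric metH)
  (hpi : riemannian_submersion metG metH pi)
  (hnablaG : levi_civita metG nablaG)
  (hnablaH : levi_civita metH nablaH)
  (hD : smooth_distribution D)
  (hD_nonint : ~ integrable_distribution D)
  (hD_inv : invariant_distribution pi Phi D)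
  (hd_hor : forall v, v \in d -> Hor metG pi 1%g v)
  (hd : (linfun (Tmap pi 1%g) @: d)%VS = D (pi 1%g))
  (hY : forall c, smooth_field (Y c))
  (hY_inv : forall c, invariant_field Phi (Y c))
  (hf_hor : forall c, Hor metG pi 1%g (f c))
  (hf : forall c, Tmap pi 1%g (f c) = Y c (pi 1%g))
  (hf_free : free [seq f c | c <- enum 'I_m])
  (hV : forall p, smooth_fun_near V p)
  (* h = f (+) d *)
  (hfd : directv (<<[seq f c | c <- enum 'I_m]>> + d))
  (hfd_hor : forall v,
     v \in (<<[seq f c | c <- enum 'I_m]>> + d)%VS <-> Hor metG pi 1%g v)
  (hu : is_the_vnc_control_law metG nablaG (V \o pi) f U u)
  (hab : a < b)
  (hsol : closed_loop_solution metG nablaG (V \o pi) f u `[a, b] g xi)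
  (hxi : xi a \in d) :
  let q := pi \o g in
  exists (qdot : R -> 'rV[R]_nH) (gdot : R -> 'rV[R]_nG),
    [/\ forall t, t \in `[a, b] ->
          is_velocity `[a, b] q t (qdot t) /\ qdot t \in D (q t),
        is_the_horizontal_lift metG pi a b q (g a) g,
        forall t, t \in `[a, b] ->
          [/\ is_velocity `[a, b] g t (gdot t),
              xi t = Tleft (g t)^-1%g (g t) (gdot t)
            & xi t \in d]
      & forall t, t \in `[a, b] ->
          is_covariant_deriv nablaH `[a, b] q qdot t
            (- grad metH V (q t)
             + \sum_(c < m) u (vsproj d (xi t)) 0 c *: Y c (q t))].
Proof.
pose E := (<<[seq f c | c <- enum 'I_m]>> + d)%VS.
have hE v : v \in E -> Hor metG pi 1%g v by move=> /hfd_hor.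
have hvel t : t \in `[a, b] ->
    is_velocity `[a, b] g t (dleft (g t) 1%g (xi t)).
  by move=> tI; have [] := hsol t tI.
have dvel t : t \in `[a, b] -> exists2 dxi, is_deriv_within `[a, b] xi t dxi &
    dxi + nabla_g nablaG (xi t) (xi t)
      + dleft (g t)^-1%g (g t) (grad metG (V \o pi) (g t))
    = \sum_(c < m) u (vsproj d (xi t)) 0 c *: f c.
  by move=> tI; have [_] := hsol t tI.
have xid t : t \in `[a, b] -> xi t \in d.
  move=> tI; have [_ [_ inv] _] := hu.
  (* Invariance of [d] is formulated for solutions starting at time [0]; the closed loop is
     autonomous, so the solution may be shifted by [a]. *)
  have := inv (b - a) (fun s => g (a + s)) (fun s => xi (a + s)).
  rewrite subr_gt0 addr0 => /(_ hab) H1.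
  have tE : t = a + (t - a) by rewrite addrC subrK.
  rewrite tE; apply: H1 => //; last by rewrite itv_shift -tE.
  move=> s; rewrite /= itv_shift => sI; split.
    exact: is_velocity_shift (hvel _ sI).
  have [dxi dx eqn] := dvel _ sI; exists dxi => //.
  exact: is_deriv_within_shift.
pose gdot t := dleft (g t) 1%g (xi t).
pose qdot t := dmap pi (g t) (gdot t).
move=> q; exists qdot, gdot; split.
- move=> t tI; split; first exact: (projection_velocity hH tI (hvel t tI)).
  have qE : q t = Phi (g t) (pi 1%g).
    by rewrite (action_projection hH) mulg1.
  rewrite qE hD_inv -hd.
  have -> : qdot t = linfun (Tmap (Phi (g t)) (pi 1%g))
      (linfun (Tmap pi 1%g) (xi t)).
    have := dmap_action hH (g t) 1%g (xi t); rewrite mulg1 /qdot /gdot => <-.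
    by rewrite !lfunE.
  by do 2!apply: memv_img; exact: xid.
- split=> // [t tI|qt' qa lift t tI].
    split=> //; exists (gdot t); first exact: hvel.
    by apply: (Hor_left hH hmetG_inv); exact/hd_hor/xid.
  (* The left-trivialised velocity of the competing lift; the value [0] outside [[a, b]] is
     arbitrary. *)
  have /choice[xi' xi'P] : forall t, exists xi', t \in `[a, b] ->
      is_velocity `[a, b] qt' t (dleft (qt' t) 1%g xi') /\ xi' \in E.
    move=> s; have [sI|] := boolP (s \in `[a, b]); last by exists 0.
    have [_ [v vv hv]] := lift s sI.
    exists (dleft (qt' s)^-1%g (qt' s) v) => _; rewrite dleftVK; split=> //.
    exact/hfd_hor/(Hor_leftV hH hmetG_inv).
  apply/esym; move: t tI.
  apply: (horizontal_lift_unique hH hmetG hmetG_inv hmetH hpi hE hab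
    (xi1 := xi) (xi2 := xi')) => //.
  + by move=> s sI; have [-> _] := lift s sI.
  + move=> s sI; split; first exact: hvel.
    by apply/hfd_hor/hd_hor/xid.
  + by move=> s sI; have [dxi /is_deriv_within_cvg] := dvel s sI.
- move=> t tI; split; [exact: hvel|exact: (esym (TleftK _ _))|exact: xid].
move=> t tI; have [dxi dx eqn] := dvel t tI.
apply: (covariant_deriv_projection hH hmetG hmetG_inv hmetH hpi hnablaG hnablaH
  hab tI hvel dx).
- exact/hd_hor/xid.
- exact/hd_hor/(deriv_within_mem hab tI xid dx).
(* Solved for its inertial part, the closed-loop equation can be compared term by term with the
   forces on [H]. *)
move=> eta; have -> : dxi + nabla_g nablaG (xi t) (xi t) =
    \sum_(c < m) u (vsproj d (xi t)) 0 c *: f c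
    - dleft (g t)^-1%g (g t) (grad metG (V \o pi) (g t)).
  by rewrite -eqn addrK.
rewrite [RHS](metDl hmetG) (metNl hmetG) (metDl hmetH) (metNl hmetH) addrC.
rewrite (met_suml hmetG) (met_suml hmetH); congr (_ - _).
  apply: eq_bigr => c _; rewrite (metZl hmetG) (metZl hmetH); congr (_ * _).
  have -> : Y c (q t) = dmap pi (g t) (dleft (g t) 1%g (f c)).
    have := dmap_action hH (g t) 1%g (f c); rewrite mulg1 => <-.
    have -> : q t = Phi (g t) (pi 1%g) by rewrite (action_projection hH) mulg1.
    by rewrite hY_inv -hf.
  rewrite (met_projection hmetG hpi); last exact: (Hor_left hH hmetG_inv).
  by have := met_dleft hmetG_inv (g t) 1%g (f c) eta; rewrite mulg1.
(* Translated back to [g t], the gradient on [G] pairs as the differential of [V \o pi], which is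
   [dV] after the tangent map of [pi]. *)
have := met_dleft hmetG_inv (g t) 1%g
  (dleft (g t)^-1%g (g t) (grad metG (V \o pi) (g t))) eta.
rewrite mulg1 dleftVK => <-; rewrite (gradP hmetG) (gradP hmetH).
have dV : is_mdiff (pi (g t)) V (dfun V (pi (g t))).
  exact: smooth_near_is_diff (hV _).
have [_ dVE] := is_mdiff_comp (@continuous_projection _ _ _ _ _ _ _ _ hH (g t))
  (is_mdiff_projection hH (g t)) dV.
exact: (esym (congr1 (@^~ (dleft (g t) 1%g eta)) dVE)).
Qed.
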